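(* Let $h>0$ and let $g:[3,\infty)\to\mathbb{R}_+$ be a function with $g(T)\to\infty$ as $T\to\infty$. For $T>3$ let $U$ be uniformly distributed on $[0,1]$. Then $$\mathbb{P}\left( \sup_{t \in [UT -h, UT + h]} \Re \log \zeta \left(\tfrac{1}{2} + it \right) \leq \log \log T + g(T) \right)\underset{T \rightarrow \infty}{\longrightarrow} 1.$$
   Context: $\log\zeta$ denotes the unique version of the logarithm of the Riemann zeta function which is real on $(1,\infty)$ and is well-defined and continuous everywhere except on the closed half-lines lying to the left of the zeros and of the pole of $\zeta$; points where it is undefined are excluded from the supremum. In particular $\Re\log\zeta(1/2+it)=\log|\zeta(1/2+it)|$ where defined. No hypothesis on the zeros of $\zeta$ is assumed. *)

(* Defs.v *)
From HB Require Import structures.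
From mathcomp Require Import all_boot all_order all_algebra.
From mathcomp Require Import all_classical all_reals all_analysis.
From mathcomp Require Import complex.

Set Implicit Arguments.
Unset Strict Implicit.
Unset Printing Implicit Defensive.

Import Order.TTheory GRing.Theory Num.Theory.
Import numFieldNormedType.Exports.

Local Open Scope classical_set_scope.
Local Open Scope complex_scope.
Local Open Scope ring_scope.

(* R[i] comes without a topology; this gives it the one of the complex modulus,
   as a normed module over itself. *)
HB.instance Definition _ (R : rcfType) := NormedModule.copy R[i] R[i]^o.

Section Zeta.
Variable R : realType.
Implicit Types (f L zeta : R[i] -> R[i]) (s rho : R[i]).

Definition cexp s : R[i] :=
  (expR (complex.Re s))%:C * (cos (complex.Im s) +i* sin (complex.Im s)).

Definition analytic_at f s0 : Prop :=
  exists (a : nat -> R[i]) (r : R), 0 < r /\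
    forall s, `|s - s0| < r%:C ->
      series (fun n => a n * (s - s0) ^+ n) @ \oo --> f s.

(* [zeta] is the analytic continuation to R[i] \ {1} of the Dirichlet series,
   whose n-th term (n >= 0) is (n + 1)^(-s) = exp (- s * ln (n + 1)).
   These conditions determine [zeta s] for s <> 1; [zeta 1] is unconstrained. *)
Definition is_riemann_zeta zeta : Prop :=
  (forall s, s != 1 -> analytic_at zeta s) /\
  (forall s, 1 < complex.Re s ->
     series (fun n => cexp (- s * (ln n.+1%:R)%:C)) @ \oo --> zeta s).

Definition left_half_line rho : set R[i] :=
  [set s | complex.Im s = complex.Im rho /\ complex.Re s <= complex.Re rho].

(* The pole 1 is listed separately, since [zeta 1] is unconstrained. *)
Definition log_zeta_dom zeta : set R[i] :=
  ~` \bigcup_(rho in [set rho | rho = 1 \/ zeta rho = 0]) left_half_line rho.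

(* For the Riemann zeta function, [log_zeta_dom zeta] is open and connected, so
   these conditions determine [L] there; [L] is unconstrained elsewhere. *)
Definition is_log_zeta zeta L : Prop :=
  [/\ {within log_zeta_dom zeta, continuous L},
      (forall s, log_zeta_dom zeta s -> cexp (L s) = zeta s) &
      (forall x : R, 1 < x -> complex.Im (L x%:C) = 0)].

Definition critical_pt (t : R) : R[i] := (2^-1 : R) +i* t.

(* Points at which the logarithm is undefined are left out of the supremum,
   which is taken in the extended reals. *)
Definition sup_Re_log_zeta zeta L (a b : R) : \bar R :=
  ereal_sup [set (complex.Re (L (critical_pt t)))%:E | t in
    [set t | a <= t <= b /\ log_zeta_dom zeta (critical_pt t)]].

End Zeta.

(* Main.v *)
Require Import Defs.
From HB Require Import structures.
From mathcomp Require Import all_boot all_order all_algebra.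
From mathcomp Require Import all_classical all_reals all_analysis.
From mathcomp Require Import complex measurable_realfun.
From mathcomp Require Import ring lra zify.

Set Implicit Arguments.
Unset Strict Implicit.
Unset Printing Implicit Defensive.

Import Order.TTheory GRing.Theory Num.Theory.
Import numFieldNormedType.Exports.

Local Open Scope classical_set_scope.
Local Open Scope complex_scope.
Local Open Scope ring_scope.

(** If |zeta(1/2 + it)| > V := e^{g(T)} log T for some t within h of UT, then
    the alternating zeta function eta(s) = (1 - 2^{1-s}) zeta(s) is at least V/3
    there, since |1 - 2^{1-s}| >= sqrt 2 - 1 on the critical line.  The series
    eta(s) = sum_n (-1)^{n-1} n^{-s} has no phase stationary modulo 1 beyond
    n = |t|, so (Kusmin-Landau) its tail is O(1), and eta may be replaced by a
    Dirichlet polynomial D of length N ~ T.  Expanding squares, the mean values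
    of |D|^2 and |D'|^2 over [-h, T + 2h] are O(log T) and O(log^3 T).  The
    Sobolev inequality
      sup_J |D|^2 <= (1/|J| + log N) int_J |D|^2 + (log N)^{-1} int_J |D'|^2,
    summed over cells J of length of order h, shows that the bad cells have
    total proportion O(log^2 T / V^2) = O(e^{-2 g(T)}).
    The identity eta = (1 - 2^{1-s}) zeta, known for Re s > 1, is carried to
    Re s = 1/2 along a horizontal line by the identity theorem for real power
    series.  Integrals are avoided: |D|^2 has an explicit trigonometric
    primitive, and the Sobolev inequality follows from the mean value theorem. *)

(** * Real power series *)

Section PowerSeries.
Variable R : realType.
Implicit Types (u a b B f : R ^nat) (c : nat -> R ^nat).

Lemma cvg_dist_le u (l p e : R) :
  u @ \oo --> l -> (\forall n \near \oo, `|u n - p| <= e) -> `|l - p| <= e.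
Proof.
move=> ul ue.
have h : `|u n - p| @[n --> \oo] --> `|l - p|.
  by apply: cvg_norm; apply: cvgB => //; exact: cvg_cst.
by rewrite -(cvg_lim _ h)//; apply: limr_le => //; apply/cvg_ex; exists `|l - p|.
Qed.

Lemma cvg_sum_nat (v : nat -> R ^nat) (l : R ^nat) (N : nat) :
  (forall i, v i @ \oo --> l i) ->
  \sum_(0 <= i < N) v i n @[n --> \oo] --> \sum_(0 <= i < N) l i.
Proof.
move=> vl; elim: N => [|N IH].
  by under eq_fun do rewrite big_geq//; rewrite big_geq//; exact: cvg_cst.
under eq_fun do rewrite big_nat_recr//=.
by rewrite big_nat_recr//=; apply: cvgD.
Qed.

Lemma series_dist_le f B (M n : nat) : (forall m, `|f m| <= B m) -> (M <= n)%N ->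
  `|series f n - series f M| <= series B n - series B M.
Proof.
move=> fB Mn; rewrite !sub_series_geq//.
by apply: (le_trans (ler_norm_sum _ _ _)); exact: ler_sum.
Qed.

(** Dominated convergence for series: past a rank M fixed by the majorant all tails are at most e/3,
    uniformly in K, and the first M terms form a finite sum, which converges as K grows. *)
Lemma tannery (S : nat -> R ^nat) f B (F : R) (G : R ^nat) :
  (forall m K, `|S m K| <= B m) -> cvgn (series B) ->
  (forall m, S m @ \oo --> f m) -> series f @ \oo --> F ->
  (forall K, series (S^~ K) @ \oo --> G K) -> G @ \oo --> F.
Proof.
move=> SB cB Sf fF SG.
have fB m : `|f m| <= B m.
  have := @cvg_dist_le (S m) (f m) 0 (B m) (Sf m).
  by rewrite !subr0; apply; apply: nearW => K; rewrite subr0.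
apply/cvgrPdist_le => e e0.
have e3 : 0 < e / 3 by lra.
(* Two partial sums are compared through the limit, hence e/6 for a tail of e/3. *)
have [M _ HM] : \forall n \near \oo, `|limn (series B) - series B n| <= e / 6.
  by move/cvgrPdist_le : cB; apply; lra.
have tail (n : nat) : (M <= n)%N -> series B n - series B M <= e / 3.
  move=> Mn; have /= := HM _ Mn; have /= := HM _ (leqnn M).
  rewrite !ler_norml => /andP[? ?] /andP[? ?]; lra.
have cut (v : R ^nat) (V : R) : (forall m, `|v m| <= B m) -> series v @ \oo --> V ->
    `|V - series v M| <= e / 3.
  move=> vB vV; apply: (cvg_dist_le vV); exists M => // n /= Mn.
  exact: (le_trans (series_dist_le vB Mn) (tail _ Mn)).
have SM : series (S^~ K) M @[K --> \oo] --> series f M.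
  by rewrite /series/=; apply: cvg_sum_nat => m; exact: Sf.
move/cvgrPdist_le : SM => /(_ _ e3) SM.
near=> K.
have h1 := cut _ _ fB fF.
have h2 := cut _ _ (SB^~ K) (SG K).
have h3 : `|series f M - series (S^~ K) M| <= e / 3 by near: K.
move: h1 h2 h3; rewrite !ler_norml => /andP[? ?] /andP[? ?] /andP[? ?].
by apply/andP; split; lra.
Unshelve. all: by end_near. Qed.

Lemma cvg_series_dominated f B : (forall m, `|f m| <= B m) -> cvgn (series B) ->
  cvgn (series f).
Proof.
move=> fB cB; apply: normed_cvg; apply: series_le_cvg cB => [m|m|m]/=; rewrite ?normr_ge0//.
by apply: le_trans (fB m).
Qed.

Definition has_pseries (a : R ^nat) (x y : R) :=
  series (fun k => a k * x ^+ k) @ \oo --> y.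

(** Interchange of summations, by Tannery's theorem with the truncation order K as parameter. The
    coefficients are the column sums, chosen once for all x. *)
Lemma pseries_sum c B (rho : R) : 0 < rho ->
  (forall m K, \sum_(0 <= k < K) `|c m k| * rho ^+ k <= B m) ->
  cvgn (series B) ->
  exists a, forall x (f : R ^nat) y, `|x| <= rho ->
    (forall m, has_pseries (c m) x (f m)) -> series f @ \oo --> y ->
    has_pseries a x y.
Proof.
move=> rho0 cB cvB.
have cmk m k : `|c m k| * rho ^+ k <= B m.
  apply: le_trans (cB m k.+1); rewrite big_nat_recr//= lerDr.
  by apply: sumr_ge0 => i _; rewrite mulr_ge0// exprn_ge0// ltW.
have ck k : cvgn (series (c^~ k)).
  have rk : 0 < rho ^+ k by rewrite exprn_gt0.
  apply: (@cvg_series_dominated _ (fun m => (rho ^+ k)^-1 * B m)).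
    by move=> m; rewrite mulrC ler_pdivlMr.
  exact: is_cvg_seriesZ.
exists (fun k => limn (series (c^~ k))) => x f y xr cf fy.
apply: (@tannery (fun m K => series (fun k => c m k * x ^+ k) K) f B _ _ _ cvB) => //.
- move=> m K; apply: le_trans (cB m K); apply: le_trans (ler_norm_sum _ _ _) _.
  apply: ler_sum => k _; rewrite normrM normrX ler_wpM2l//.
  by rewrite lerXn2r// nnegrE ?normr_ge0 ?(ltW rho0).
- move=> K; rewrite [X in X @ _ --> _](_ : _ = fun n => \sum_(0 <= k < K) series (c^~ k) n * x ^+ k).
    by rewrite /series/=; apply: cvg_sum_nat => k; apply: cvgMr_tmp; exact: ck.
  apply/funext => n; rewrite /series/= exchange_big/=.
  by apply: eq_bigr => k _; rewrite mulr_suml.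
Qed.


Lemma geometric_le2 (q : R) K : 0 <= q -> q <= 2^-1 -> \sum_(0 <= k < K) q ^+ k <= 2.
Proof.
move=> q0 q2; elim: K => [|K IH]; first by rewrite big_geq.
rewrite big_nat_recl//= expr0.
under eq_bigr do rewrite exprS.
rewrite -mulr_sumr.
have : q * (\sum_(0 <= k < K) q ^+ k) <= 2^-1 * 2.
  by apply: ler_pM => //; apply: sumr_ge0 => i _; exact: exprn_ge0.
by lra.
Qed.

Lemma has_pseries_bounded a (r y : R) : has_pseries a r y ->
  exists M : R, 0 <= M /\ forall k, `|a k * r ^+ k| <= M.
Proof.
move=> ay; have /cvg_series_bounded : cvgn (series (fun k => a k * r ^+ k)).
  by apply/cvg_ex; exists y.
move=> [M0 [_ HM]]; exists (`|M0| + 1); split => [|k]; first by rewrite addr_ge0.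
by apply: HM => //; rewrite (le_lt_trans (ler_norm M0))// ltrDl.
Qed.

(** Terms bounded at r decay geometrically within r/2, with ratio at most 1/2; the resulting bound
    is uniform in [rho]. *)
Lemma has_pseries_abs a (r y : R) : 0 < r -> has_pseries a r y ->
  exists M : R, forall rho K, 0 <= rho <= r / 2 ->
    \sum_(0 <= k < K) `|a k| * rho ^+ k <= M.
Proof.
move=> r0 /has_pseries_bounded[M [M0 HM]]; exists (M * 2) => rho K /andP[p0 pr].
have q0 : 0 <= rho / r by rewrite divr_ge0// ltW.
have q2 : rho / r <= 2^-1 by rewrite ler_pdivrMr// mulrC.
apply: le_trans (ler_wpM2l M0 (geometric_le2 K q0 q2)).
rewrite mulr_sumr; apply: ler_sum => k _.
rewrite exprMn exprVn mulrCA [leLHS]mulrC ler_wpM2l ?exprn_ge0//.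
by rewrite ler_pdivlMr ?exprn_gt0// -(ger0_norm (exprn_ge0 k (ltW r0))) -normrM.
Qed.

(** Strong induction: once the lower coefficients vanish, $a_k x^k$ is minus the tail, of size
    $O(x^{k+1})$; divide by $x^k$ and let x tend to 0. Vanishing is asked for x > 0 only, since the
    identity theorem below knows the function on one side. *)
Lemma pseries_eq0 a (r : R) : 0 < r ->
  (forall x, 0 < x -> x <= r -> has_pseries a x 0) -> forall k, a k = 0.
Proof.
move=> r0 a0; have [M [M0 HM]] := has_pseries_bounded (a0 r r0 (lexx r)).
move=> k; elim/ltn_ind: k => k IH.
have bnd x : 0 < x -> x <= r / 2 -> `|a k| <= M * 2 * x / r ^+ k.+1.
  move=> x0 xr; have q0 : 0 <= x / r by rewrite divr_ge0// ltW.
  have q2 : x / r <= 2^-1 by rewrite ler_pdivrMr// mulrC.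
  have xr' : x <= r by apply: (le_trans xr); lra.
  have : `|0 - a k * x ^+ k| <= M * 2 * (x / r) ^+ k.+1.
    apply: (cvg_dist_le (a0 x x0 xr')); exists k.+1 => // n /= kn.
    have -> : series (fun j => a j * x ^+ j) n - a k * x ^+ k =
        \sum_(k.+1 <= j < n) a j * x ^+ j.
      rewrite /series/= (@big_cat_nat _ _ _ k)//=; last exact: ltnW.
      rewrite big_nat_cond big1 ?add0r; last first.
        by move=> i /andP[/andP[_ ik] _]; rewrite IH// mul0r.
      by rewrite big_ltn// addrAC subrr add0r.
    apply: le_trans (ler_norm_sum _ _ _) _.
    rewrite -{1}(add0n k.+1) big_addn; apply: (@le_trans _ _ (\sum_(0 <= j < n - k.+1)
        M * (x / r) ^+ k.+1 * (x / r) ^+ j)).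
      apply: ler_sum => i _; rewrite -mulrA -exprD [(k.+1 + i)%N]addnC exprMn exprVn mulrCA.
      rewrite normrM (ger0_norm (exprn_ge0 _ (ltW x0))) mulrC ler_wpM2l ?exprn_ge0 ?(ltW x0)//.
      rewrite ler_pdivlMr ?exprn_gt0// -(ger0_norm (exprn_ge0 _ (ltW r0))) -normrM.
      exact: HM.
    rewrite -mulr_sumr [leRHS]mulrAC ler_wpM2l//; last exact: geometric_le2.
    by rewrite mulr_ge0// exprn_ge0.
  rewrite sub0r normrN normrM (ger0_norm (exprn_ge0 _ (ltW x0))).
  rewrite -ler_pdivlMr ?exprn_gt0//; congr (_ <= _).
  rewrite exprMn exprVn !exprS; field.
  by rewrite !gt_eqF// exprn_gt0.
apply/eqP; rewrite -normr_le0; apply/ler_addgt0Pl => e e0; rewrite addr0.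
have rk : 0 < r ^+ k.+1 by rewrite exprn_gt0.
(* Small enough for [bnd] and to bring its bound below e; adding 1 keeps the denominator positive
   when M = 0. *)
pose x := Num.min (r / 2) (e * r ^+ k.+1 / (M * 2 + 1)).
have M1 : 0 < M * 2 + 1 by lra.
have x0 : 0 < x by rewrite lt_min !divr_gt0// mulr_gt0.
apply: (le_trans (bnd x x0 _)); first by rewrite ge_min lexx.
rewrite ler_pdivrMr//; apply: (@le_trans _ _ ((M * 2 + 1) * x)).
  by rewrite ler_wpM2r ?(ltW x0)// lerDl.
by rewrite mulrC -ler_pdivlMr// ge_min lexx orbT.
Qed.

Lemma has_pseries_lc (a b : R ^nat) (p q x y z : R) :
  has_pseries a x y -> has_pseries b x z ->
  has_pseries (fun k => p * a k + q * b k) x (p * y + q * z).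
Proof.
move=> ay bz; rewrite /has_pseries [X in X @ _ --> _](_ : _ = fun n =>
    p * series (fun k => a k * x ^+ k) n + q * series (fun k => b k * x ^+ k) n).
  by apply: cvgD; apply: cvgMl_tmp.
apply/funext => n; rewrite /series/= !mulr_sumr -big_split/=.
by apply: eq_bigr => k _; rewrite mulrDl !mulrA.
Qed.

(** The closed range |x| <= r makes the series converge at r itself, which is what yields geometric
    domination on r/2. *)
Definition ranalytic (f : R -> R) (x0 : R) := exists (a : R ^nat) (r : R),
  0 < r /\ forall x, `|x| <= r -> has_pseries a x (f (x0 + x)).

(** Identity theorem, from right to left. At the infimum s of the points after which h vanishes up
    to c, the expansion of h is zero on the right, so its coefficients vanish and h is zero to the
    left of s as well; hence s = A. *)
Lemma ranalytic_zero (h : R -> R) (A b c : R) : A <= b -> b < c ->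
  (forall x, A <= x <= c -> ranalytic h x) ->
  (forall x, b < x -> x <= c -> h x = 0) -> h A = 0.
Proof.
move=> Ab bc han h0.
pose S := [set y | A <= y /\ y <= b /\ forall x, y < x -> x <= c -> h x = 0].
have Sb : S b by [].
have infS : has_inf S by split; [exists b | exists A => y []].
set s := inf S.
have As : A <= s by apply: lb_le_inf; [exists b | move=> y []].
have sb : s <= b by apply: ge_inf => //; case: infS.
have hs x : s < x -> x <= c -> h x = 0.
  move=> sx xc; have [y [_ [_ Sy]] yx] := inf_lt infS.1 sx.
  exact: Sy.
have [a [r [r0 ar]]] : ranalytic h s by apply: han; rewrite As/=; lra.
have a0 : forall k, a k = 0.
  apply: (@pseries_eq0 a (Num.min r (c - s))).
    by rewrite lt_min r0/=; lra.
  move=> x x0; rewrite le_min => /andP[xr xc].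
  rewrite -(hs (s + x)); first by apply: ar; rewrite gtr0_norm.
    by lra.
  by lra.
have hr x : `|x| <= r -> h (s + x) = 0.
  move=> /ar; rewrite /has_pseries (_ : (fun k => _) = fun=> 0).
    rewrite /series/=; under eq_fun do rewrite big1//.
    by move=> H; rewrite -(cvg_lim _ H)// lim_cst.
  by apply/funext => k; rewrite a0 mul0r.
have [sA|As'] := leP s A.
  have -> : A = s + 0 by lra.
  by apply: hr; rewrite normr0 ltW.
pose y := Num.max A (s - r).
have ys : y < s by rewrite gt_max As'/=; lra.
have : S y.
  split; first by rewrite le_max lexx.
  split; first by apply: (le_trans (ltW ys)).
  move=> x yx xc; have [sx|xs] := ltP s x; first exact: hs.
  have -> : x = s + (x - s) by lra.
  apply: hr; rewrite ler0_norm; last by lra.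
  by move: yx; rewrite gt_max => /andP[_]; lra.
by move=> /(ge_inf infS.2); rewrite leNgt ys.
Qed.

Lemma ranalytic_lc (f g : R -> R) (p q x0 : R) : ranalytic f x0 -> ranalytic g x0 ->
  ranalytic (fun x => p * f x + q * g x) x0.
Proof.
move=> [a [r [r0 ar]]] [b [s [s0 bs]]].
exists (fun k => p * a k + q * b k), (Num.min r s); split; first by rewrite lt_min r0.
move=> x; rewrite le_min => /andP[/ar ax /bs bx].
exact: has_pseries_lc.
Qed.

(** Cauchy product, by [pseries_sum] applied to its rows; half the radius gives absolute convergence
    of both factors. *)
Lemma ranalytic_mul (f g : R -> R) (x0 : R) : ranalytic f x0 -> ranalytic g x0 ->
  ranalytic (fun x => f x * g x) x0.
Proof.
move=> [a [r [r0 ar]]] [b [s [s0 bs]]].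
have [Ma HMa] : exists M : R, forall rho K, 0 <= rho <= r / 2 ->
    \sum_(0 <= k < K) `|a k| * rho ^+ k <= M.
  by apply: (has_pseries_abs r0 (ar r _)); rewrite gtr0_norm.
have [Mb HMb] : exists M : R, forall rho K, 0 <= rho <= s / 2 ->
    \sum_(0 <= k < K) `|b k| * rho ^+ k <= M.
  by apply: (has_pseries_abs s0 (bs s _)); rewrite gtr0_norm.
pose rho := Num.min (r / 2) (s / 2).
have rho0 : 0 < rho by rewrite lt_min !divr_gt0.
have rhor : 0 <= rho <= r / 2 by rewrite ltW//= ge_min lexx.
have rhos : 0 <= rho <= s / 2 by rewrite ltW//= ge_min lexx orbT.
(* Row m is $a_m x^m$ times the series of b, so its coefficients are shifted by m. *)
pose c m k := if (m <= k)%N then a m * b (k - m)%N else 0.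
have cshift m (F : nat -> R) K : (forall k, (k < m)%N -> F k = 0) ->
    \sum_(0 <= k < K + m) F k = \sum_(0 <= j < K) F (j + m)%N.
  move=> F0; rewrite (@big_cat_nat _ _ _ m)//=; last by rewrite leq_addl.
  rewrite big_nat_cond big1 ?add0r; last first.
    by move=> i /andP[/andP[_ im] _]; rewrite F0.
  by rewrite -{1}(add0n m) big_addn addnK.
have [||d hd] := @pseries_sum c (fun m => `|a m| * rho ^+ m * Mb) rho rho0 _ _.
- move=> m K; apply: (@le_trans _ _ (\sum_(0 <= k < K + m) `|c m k| * rho ^+ k)).
    rewrite [leRHS](@big_cat_nat _ _ _ K)//= ?leq_addr// lerDl.
    by apply: sumr_ge0 => i _; rewrite mulr_ge0// exprn_ge0// ltW.
  rewrite cshift; last by move=> k km; rewrite /c leqNgt km normr0 mul0r.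
  apply: le_trans (ler_wpM2l _ (HMb rho K rhos)); last first.
    by rewrite mulr_ge0// exprn_ge0// ltW.
  rewrite mulr_sumr; apply: ler_sum => k _.
  by rewrite /c leq_addl addnK exprD normrM le_eqVlt; apply/orP; left; apply/eqP; ring.
- have Mb0 : 0 <= Mb by apply: le_trans (HMb rho 0%N rhos); rewrite big_geq.
  apply: nondecreasing_is_cvgn.
    apply: nondecreasing_series => k _ _.
    by rewrite !mulr_ge0// exprn_ge0// ltW.
  exists (Ma * Mb) => _ [n _ <-]; rewrite /series/= -mulr_suml ler_wpM2r//.
  exact: HMa.
- exists d, rho; split => // x xr.
  have xr' : `|x| <= r by apply: (le_trans xr); move/andP: rhor => [_ h]; lra.
  have xs' : `|x| <= s by apply: (le_trans xr); move/andP: rhos => [_ h]; lra.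
  apply: (hd x (fun m => a m * x ^+ m * g (x0 + x))) => //.
  + move=> m; rewrite /has_pseries -(cvg_shiftn m).
    rewrite [X in X @ _ --> _](_ : _ = fun n =>
        a m * x ^+ m * series (fun k => b k * x ^+ k) n).
      by apply: cvgMl_tmp; exact: bs.
    apply/funext => n; rewrite /series/= cshift; last first.
      by move=> k km; rewrite /c leqNgt km mul0r.
    rewrite mulr_sumr; apply: eq_bigr => k _.
    by rewrite /c leq_addl addnK exprD; ring.
  + rewrite [X in X @ _ --> _](_ : _ = fun n =>
        series (fun k => a k * x ^+ k) n * g (x0 + x)).
      by apply: cvgMr_tmp; exact: ar.
    by apply/funext => n; rewrite /series/= mulr_suml.
Qed.

End PowerSeries.

(** * Mean squares of trigonometric polynomials *)

Section MeanSquare.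
Variable R : realType.
Implicit Types (a l : R ^nat) (N : nat).

(** This is $|\sum_j a_j e^{\mathrm{i} t l_j}|^2$, written with real functions. *)
Definition trig_sq a l N (t : R) : R :=
  (\sum_(i < N) a i * cos (t * l i)) ^+ 2 + (\sum_(i < N) a i * sin (t * l i)) ^+ 2.

(** For distinct frequencies, the integral of [trig_sq] from 0 to t, found by expanding the square:
    the diagonal grows with t and the rest stays bounded. *)
Definition trig_sq_prim a l N (t : R) : R :=
  \sum_(i < N) \sum_(j < N) a i * a j *
    (if i == j then t else sin (t * (l i - l j)) / (l i - l j)).

Lemma trig_sqE a l N t :
  trig_sq a l N t = \sum_(i < N) \sum_(j < N) a i * a j * cos (t * (l i - l j)).
Proof.
rewrite /trig_sq !expr2 !mulr_suml -big_split/=; apply: eq_bigr => i _.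
rewrite !mulr_sumr -big_split/=; apply: eq_bigr => j _.
by rewrite mulrBr cosB; ring.
Qed.

Lemma trig_sq_ge0 a l N t : 0 <= trig_sq a l N t.
Proof. by rewrite addr_ge0// sqr_ge0. Qed.

Lemma is_derive_sumf N (f df : 'I_N -> R -> R) (t : R) :
  (forall i, is_derive t 1 (f i) (df i t)) ->
  is_derive t 1 (fun t => \sum_(i < N) f i t) (\sum_(i < N) df i t).
Proof.
move=> h; have -> : (fun t => \sum_(i < N) f i t) = \sum_(i < N) f i.
  by apply/funext => x; rewrite fct_sumE.
exact: is_derive_sum.
Qed.

Lemma is_derive_scalef (k : R) (f : R -> R) (d t : R) :
  is_derive t 1 f d -> is_derive t 1 (fun t => k * f t) (k * d).
Proof. exact: is_deriveZ. Qed.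

Lemma is_derive_linf (w t : R) : is_derive t 1 (fun t => t * w) w.
Proof.
have -> : (fun t => t * w) = (fun t : R => w * t) by apply/funext => x; rewrite mulrC.
by have := is_derive_scalef w (is_derive_id t (1 : R)); rewrite mulr1.
Qed.

Lemma is_derive_sin_lin (w t : R) :
  is_derive t 1 (fun t => sin (t * w)) (w * cos (t * w)).
Proof.
rewrite mulrC; apply: (@is_derive1_comp _ sin (fun t => t * w)).
exact: is_derive_linf.
Qed.

Lemma is_derive_cos_lin (w t : R) :
  is_derive t 1 (fun t => cos (t * w)) (- (w * sin (t * w))).
Proof.
rewrite mulrC -mulNr; apply: (@is_derive1_comp _ cos (fun t => t * w)).
exact: is_derive_linf.
Qed.

Lemma trig_sq_prim_derive a l N (t : R) : injective l ->
  is_derive t 1 (trig_sq_prim a l N) (trig_sq a l N t).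
Proof.
move=> l_inj; rewrite trig_sqE.
apply: (@is_derive_sumf N _ (fun i t => \sum_(j < N) a i * a j * cos (t * (l i - l j)))) => i.
apply: (@is_derive_sumf N _ (fun j t => a i * a j * cos (t * (l i - l j)))) => j.
have [->|ij] := eqVneq i j.
  by apply: is_derive_scalef; rewrite subrr mulr0 cos0; exact: is_derive_id.
apply: is_derive_scalef; have lij : l i - l j != 0.
  by rewrite subr_eq0; apply: contra ij => /eqP/l_inj/ord_inj ->.
have -> : (fun t => sin (t * (l i - l j)) / (l i - l j)) =
    (fun t => (l i - l j)^-1 * sin (t * (l i - l j))).
  by apply/funext => x; rewrite mulrC.
have := is_derive_scalef (l i - l j)^-1 (is_derive_sin_lin (l i - l j) t).
by rewrite mulrA mulVf// mul1r.
Qed.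

Definition trig_sq_der a l N (t : R) : R :=
  2 * ((\sum_(i < N) a i * cos (t * l i)) * (- \sum_(i < N) a i * l i * sin (t * l i)) +
       (\sum_(i < N) a i * sin (t * l i)) * (\sum_(i < N) a i * l i * cos (t * l i))).

Lemma trig_sq_is_derive a l N (t : R) : is_derive t 1 (trig_sq a l N) (trig_sq_der a l N t).
Proof.
have hC : is_derive t 1 (fun t => \sum_(i < N) a i * cos (t * l i))
    (- \sum_(i < N) a i * l i * sin (t * l i)).
  rewrite -sumrN.
  apply: (@is_derive_sumf N _ (fun i t => - (a i * l i * sin (t * l i)))) => i.
  by rewrite -mulrA -mulrN; apply: is_derive_scalef; exact: is_derive_cos_lin.
have hS : is_derive t 1 (fun t => \sum_(i < N) a i * sin (t * l i))
    (\sum_(i < N) a i * l i * cos (t * l i)).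
  apply: (@is_derive_sumf N _ (fun i t => (a i * l i * cos (t * l i)))) => i.
  by rewrite -mulrA; apply: is_derive_scalef; exact: is_derive_sin_lin.
have h := is_deriveD (is_deriveX 2 hC) (is_deriveX 2 hS).
apply: (is_derive_eq h).
by rewrite /trig_sq_der /= !expr1 /GRing.scale/=; ring.
Qed.

(** With $D = \sum_j a_j e^{\mathrm{i} t l_j}$, the derivative of $|D|^2$ is $2 \Re(\bar D D')$, and
    the coefficients $a_j l_j$ give $|D'|^2$; the bound is the inequality of arithmetic and
    geometric means. *)
Lemma trig_sq_der_le a l N (lam t : R) : 0 < lam ->
  `|trig_sq_der a l N t| <=
  lam * trig_sq a l N t + trig_sq (fun i => a i * l i) l N t / lam.
Proof.
move=> lam0; rewrite /trig_sq_der /trig_sq.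
set C := \sum_(i < N) a i * cos _; set S := \sum_(i < N) a i * sin _.
set S' := \sum_(i < N) a i * l i * cos _; set C' := \sum_(i < N) a i * l i * sin _.
have amgm (x y : R) : - (lam * x ^+ 2 + y ^+ 2 / lam) <= 2 * (x * y) /\
    2 * (x * y) <= lam * x ^+ 2 + y ^+ 2 / lam.
  have h (z : R) : 0 <= z ^+ 2 / lam by rewrite mulr_ge0 ?sqr_ge0// invr_ge0 ltW.
  have := h (lam * x + y); have := h (lam * x - y).
  have -> : (lam * x - y) ^+ 2 / lam = lam * x ^+ 2 - 2 * (x * y) + y ^+ 2 / lam.
    by field; rewrite gt_eqF.
  have -> : (lam * x + y) ^+ 2 / lam = lam * x ^+ 2 + 2 * (x * y) + y ^+ 2 / lam.
    by field; rewrite gt_eqF.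
  by split; lra.
have [h1 h2] := amgm C (- C'); have [h3 h4] := amgm S S'.
rewrite sqrrN in h1 h2.
have -> : (S' ^+ 2 + C' ^+ 2) / lam = S' ^+ 2 / lam + C' ^+ 2 / lam by rewrite mulrDl.
by rewrite ler_norml; apply/andP; split; lra.
Qed.

Lemma ge0_derive_le (f df : R -> R) (x y : R) :
  (forall x : R, is_derive x 1 f (df x)) -> (forall x, 0 <= df x) -> x <= y -> f x <= f y.
Proof.
move=> fd df0 xy; have fc : {within `[x, y], continuous f}.
  by apply: derivable_within_continuous => z zxy; have [] := fd z.
have [] := MVT_segment xy (fun z _ => fd z) fc.
by move=> c _; rewrite -subr_ge0 => ->; rewrite mulr_ge0// subr_ge0.
Qed.

(** The mean value theorem supplies c where q equals its average on [a, b]. With H = lam G + K /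
    lam, both H - q and H + q are nondecreasing, so q(t) exceeds q(c) by at most H(b) - H(a), on
    whichever side of c the point t lies. *)
Lemma sobolev_sup (q dq G q2 K : R -> R) (lam a b t : R) :
  0 < lam -> a < b -> a <= t <= b ->
  (forall x : R, is_derive x 1 q (dq x)) -> (forall x : R, is_derive x 1 G (q x)) ->
  (forall x : R, is_derive x 1 K (q2 x)) -> (forall x, 0 <= q x) -> (forall x, 0 <= q2 x) ->
  (forall x, `|dq x| <= lam * q x + q2 x / lam) ->
  q t <= ((b - a)^-1 + lam) * (G b - G a) + lam^-1 * (K b - K a).
Proof.
move=> lam0 ab /andP[at_ tb] qd Gd Kd q0 q20 dqle.
have Gc : {within `[a, b], continuous G}.
  by apply: derivable_within_continuous => z zab; have [] := Gd z.
have [c] := MVT ab (fun z _ => Gd z) Gc.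
rewrite in_itv/= => /andP[ac cb] Gab.
have lamV : 0 < lam^-1 by rewrite invr_gt0.
pose H x := lam * G x + lam^-1 * K x.
have Hd (x : R) : is_derive x 1 H (lam * q x + lam^-1 * q2 x).
  by apply: is_deriveD; apply: is_derive_scalef.
have Hm x y : x <= y -> H x <= H y.
  by apply: ge0_derive_le Hd _ => z; rewrite addr_ge0// mulr_ge0// ltW.
have H1 x y : x <= y -> H x - q x <= H y - q y.
  apply: (@ge0_derive_le (fun x => H x - q x) _ x y (fun x => is_deriveB (Hd x) (qd x))) => z.
  have := dqle z; rewrite ler_norml => /andP[? ?].
  by rewrite subr_ge0 [lam^-1 * _]mulrC.
have H2 x y : x <= y -> H x + q x <= H y + q y.
  apply: (@ge0_derive_le (fun x => H x + q x) _ x y (fun x => is_deriveD (Hd x) (qd x))) => z.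
  have := dqle z; rewrite ler_norml => /andP[? ?].
  by rewrite [lam^-1 * _]mulrC; lra.
have qc : q c = (b - a)^-1 * (G b - G a).
  by rewrite Gab; field; lra.
have -> : ((b - a)^-1 + lam) * (G b - G a) + lam^-1 * (K b - K a) = q c + (H b - H a).
  by rewrite qc /H; ring.
have [ct|tc] := leP c t.
  by have := H1 _ _ ct; have := Hm _ _ tb; have := Hm _ _ (ltW ac); lra.
by have := H2 _ _ (ltW tc); have := Hm _ _ at_; have := Hm _ _ (ltW cb); lra.
Qed.

Lemma trig_sq_prim_dist a l N (x y : R) : injective l ->
  `|trig_sq_prim a l N x - trig_sq_prim a l N y| <=
  \sum_(i < N) \sum_(j < N) `|a i * a j| *
    (if i == j then `|x - y| else 2 / `|l i - l j|).
Proof.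
move=> l_inj; rewrite /trig_sq_prim -sumrB.
apply: le_trans (ler_norm_sum _ _ _) _; apply: ler_sum => i _.
rewrite -sumrB; apply: le_trans (ler_norm_sum _ _ _) _; apply: ler_sum => j _.
rewrite -mulrBr normrM ler_wpM2l//; have [//|ij] := eqVneq i j.
rewrite -mulrBl normrM normfV ler_wpM2r ?invr_ge0//.
apply: (le_trans (ler_normB _ _)).
by have := sin_max (x * (l i - l j)); have := sin_max (y * (l i - l j)); lra.
Qed.

(** * Mean values of Dirichlet polynomials *)

(* Dirichlet series are indexed from 0: the n-th frequency is ln (n + 1). *)
Definition lnS (n : nat) : R := ln n.+1%:R.

Lemma lnS_inj : injective lnS.
Proof.
move=> m n /ln_inj; rewrite !posrE !ltr0n => /(_ isT isT)/eqP.
by rewrite eqr_nat => /eqP[].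
Qed.

Lemma lnS_ge0 n : 0 <= lnS n.
Proof. by rewrite ln_ge0// ler1n. Qed.

Lemma ler_lnS m n : (m <= n)%N -> lnS m <= lnS n.
Proof. by move=> mn; rewrite ler_ln ?posrE ?ltr0n// ler_nat. Qed.

Lemma expR_lnS n : expR (lnS n) = n.+1%:R.
Proof. by rewrite lnK// posrE ltr0n. Qed.

Lemma lnS_sub_ge m n : (m <= n)%N -> (n - m)%:R / n.+1%:R <= lnS n - lnS m.
Proof.
move=> mn; have n0 : (0 : R) < n.+1%:R by rewrite ltr0n.
have m0 : (0 : R) < m.+1%:R by rewrite ltr0n.
have -> : lnS n - lnS m = - ln (m.+1%:R / n.+1%:R) by rewrite ln_div ?posrE// opprB.
rewrite lerNr.
have -> : m.+1%:R / n.+1%:R = 1 + - ((n - m)%:R / n.+1%:R) :> R.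
  rewrite -(subSS m n) natrB//.
  by move: n0 m0; move: (n.+1%:R : R) (m.+1%:R : R) => u v u0 v0; field; rewrite gt_eqF.
apply: le_ln1Dx; rewrite ltrN2 ltr_pdivrMr// mul1r ltr_nat ltnS; exact: leq_subr.
Qed.

Lemma lnS_sub_le m n : (m <= n)%N -> lnS n - lnS m <= (n - m)%:R / m.+1%:R.
Proof.
move=> mn; have n0 : (0 : R) < n.+1%:R by rewrite ltr0n.
have m0 : (0 : R) < m.+1%:R by rewrite ltr0n.
rewrite /lnS -ln_div ?posrE//.
have -> : n.+1%:R / m.+1%:R = 1 + ((n - m)%:R / m.+1%:R) :> R.
  rewrite -(subSS m n) natrB//.
  by move: n0 m0; move: (n.+1%:R : R) (m.+1%:R : R) => u v u0 v0; field; rewrite gt_eqF.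
by apply: le_ln1Dx; rewrite (@lt_le_trans _ _ 0)// ?ltrN10// divr_ge0.
Qed.

Lemma series_harmonic_le N : series (@harmonic R) N.+1 <= 1 + lnS N.
Proof.
elim: N => [|N IH].
  by rewrite /series/= big_nat1 /harmonic/= /lnS ln1 addr0 invr1.
have := @lnS_sub_ge N N.+1 (leqnSn N); rewrite subSnn div1r => h.
have -> : series (@harmonic R) N.+2 = series (@harmonic R) N.+1 + N.+2%:R^-1.
  by rewrite [LHS]seriesSr.
by move: h IH; move: (series _ _) (N.+2%:R^-1 : R) => u v; lra.
Qed.

Lemma ler_series_harmonic m n : (m <= n)%N ->
  series (@harmonic R) m <= series (@harmonic R) n.
Proof.
move=> mn; apply: nondecreasing_series => // k _ _; exact: harmonic_ge0.
Qed.

(* The diagonal term is 0 because 0^-1 = 0. *)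
Lemma sum_inv_dist_le N i : (i < N)%N ->
  \sum_(0 <= j < N) ((i - j) + (j - i))%:R^-1 <= 2 * series (@harmonic R) N.
Proof.
move=> iN; rewrite (@big_cat_nat _ _ _ i)//=; last exact: ltnW.
have -> : 2 * series (@harmonic R) N = series (@harmonic R) N + series (@harmonic R) N.
  by move: (series _ _) => u; ring.
apply: lerD.
  apply: (@le_trans _ _ (series (@harmonic R) i)); last exact/ler_series_harmonic/ltnW.
  rewrite big_nat_rev/= add0n /series/= !big_nat; apply: ler_sum => j /andP[_ ji].
  rewrite /harmonic/= (_ : _ + _ = j.+1)%N//; lia.
rewrite big_ltn// subnn addn0 invr0 add0r -{1}(add0n i.+1) big_addn.
apply: le_trans (ler_series_harmonic (leq_subr i.+1 N)).
rewrite /series/=; apply: ler_sum => j _.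
rewrite /harmonic/= (_ : _ + _ = j.+1)%N//; lia.
Qed.

(** The diagonal yields |x - y| times the harmonic sum; the other terms are bounded by reciprocals
    of i + 1, j + 1 and |i - j|, whose double sums are each at most a multiple of N times the
    harmonic sum. *)
Lemma trig_sq_prim_lnS_dist a (A : R) N (x y : R) : 0 <= A ->
  (forall i, (i < N)%N -> `|a i| <= A * expR (- (lnS i / 2))) ->
  `|trig_sq_prim a lnS N x - trig_sq_prim a lnS N y| <=
  A ^+ 2 * series (@harmonic R) N * (`|x - y| + 8 * N%:R).
Proof.
move=> A0 aA; apply: le_trans (trig_sq_prim_dist a N x y lnS_inj) _.
set H := series _ _.
pose w i j : R := ((i - j) + (j - i))%:R^-1.
(* From $\ln\frac{j+1}{i+1} \ge \frac{j-i}{j+1}$ and $\frac{j+1}{(i+1)(j-i)} = \frac1{j-i} +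
   \frac1{i+1}$. *)
have off i j : (i < j)%N ->
    expR (- (lnS i / 2)) * expR (- (lnS j / 2)) * (2 / `|lnS i - lnS j|) <=
    2 * (w i j + i.+1%:R^-1).
  move=> ij; have ij' := ltnW ij.
  have d0 : (0 : R) < (j - i)%:R by rewrite ltr0n subn_gt0.
  have i0 : (0 : R) < i.+1%:R by rewrite ltr0n.
  have j0 : (0 : R) < j.+1%:R by rewrite ltr0n.
  have e : expR (- (lnS i / 2)) * expR (- (lnS j / 2)) <= i.+1%:R^-1.
    rewrite -expRD -[i.+1%:R]expR_lnS -expRN ler_expR; have := ler_lnS ij'; lra.
  have l1 := lnS_sub_ge ij'.
  have q0 : 0 < (j - i)%:R / j.+1%:R :> R by rewrite divr_gt0.
  rewrite distrC ger0_norm; last by apply: le_trans l1; exact: ltW.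
  apply: (@le_trans _ _ (i.+1%:R^-1 * (2 / ((j - i)%:R / j.+1%:R)))).
    apply: ler_pM => //.
    - by rewrite divr_ge0//; apply: le_trans l1; exact: ltW.
    - by rewrite ler_wpM2l// lef_pV2 ?posrE//; apply: lt_le_trans l1.
  rewrite /w (_ : (i - j)%N = 0%N) ?add0n; last by apply/eqP; rewrite subn_eq0.
  rewrite le_eqVlt; apply/orP; left; apply/eqP.
  rewrite natrB// -!natr1; field.
  by rewrite !natr1 subr_eq0 eqr_nat !pnatr_eq0/= andbT; rewrite gtn_eqF.
(* Both 1/(i+1) and 1/(j+1) are kept, so that one bound covers i < j and j < i. Over N rows the
   terms without |x - y| add up to 2 (2 + 1 + 1) N H = 8 N H. *)
have row i : (i < N)%N -> \sum_(j < N) `|a i * a j| *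
    (if (i : nat) == j then `|x - y| else 2 / `|lnS i - lnS j|) <=
    A ^+ 2 * (`|x - y| * i.+1%:R^-1 + 2 * (2 * H + N%:R * i.+1%:R^-1 + H)).
  move=> iN.
  have -> : A ^+ 2 * (`|x - y| * i.+1%:R^-1 + 2 * (2 * H + N%:R * i.+1%:R^-1 + H)) =
    A ^+ 2 * (`|x - y| * i.+1%:R^-1 + 2 * (2 * H)) +
    \sum_(j < N) A ^+ 2 * (2 * (i.+1%:R^-1 + harmonic j)).
    rewrite -!mulr_sumr big_split/= sumr_const card_ord -mulr_natl.
    by rewrite /H /series/= big_mkord; ring.
  apply: (@le_trans _ _ (\sum_(j < N) A ^+ 2 * ((i == j)%:R * (`|x - y| * i.+1%:R^-1)
     + 2 * w i j + 2 * (i.+1%:R^-1 + harmonic j)))).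
    apply: ler_sum => j _.
    have [j0 i0] : (0 : R) < j.+1%:R^-1 /\ (0 : R) < i.+1%:R^-1 by rewrite !invr_gt0 !ltr0n.
    have w0 : 0 <= w i j by rewrite invr_ge0.
    have aij : `|a i * a j| <= A ^+ 2 * (expR (- (lnS i / 2)) * expR (- (lnS j / 2))).
      rewrite normrM (_ : A ^+ 2 * _ = A * expR (- (lnS i / 2)) * (A * expR (- (lnS j / 2)))).
        by apply: ler_pM => //; exact: aA.
      by ring.
    have A20 : 0 <= A ^+ 2 by rewrite sqr_ge0.
    apply: (@le_trans _ _ (A ^+ 2 * (expR (- (lnS i / 2)) * expR (- (lnS j / 2))) *
      (if (i : nat) == j then `|x - y| else 2 / `|lnS i - lnS j|))).
      by apply: ler_wpM2r aij; case: ifP => // _; rewrite divr_ge0.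
    rewrite -mulrA ler_wpM2l//.
    have [<-|ij] := eqVneq i (nat_of_ord j).
      rewrite -expRD (_ : - (lnS i / 2) - lnS i / 2 = - lnS i); last by field.
      rewrite expRN expR_lnS mulrC mul1r -addrA lerDl.
      have wii : 0 <= w i i by rewrite invr_ge0.
      by rewrite addr_ge0// mulr_ge0// addr_ge0// ?harmonic_ge0// ltW.
    rewrite mul0r add0r /harmonic/=; move: ij; rewrite neq_ltn => /orP[ij|ji].
      move: (off _ _ ij) j0 i0 w0.
      by move: (j.+1%:R^-1 : R) (i.+1%:R^-1 : R) (w i j) (2 / _) => u v z c; lra.
    have := off _ _ ji; rewrite distrC [w j i](_ : _ = w i j); last by rewrite /w addnC.
    rewrite [expR (- (lnS j / 2)) * _]mulrC; move: j0 i0 w0.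
    by move: (j.+1%:R^-1 : R) (i.+1%:R^-1 : R) (w i j) (2 / _) => u v z c; lra.
  have -> : \sum_(j < N) A ^+ 2 * ((i == j)%:R * (`|x - y| * i.+1%:R^-1)
      + 2 * w i j + 2 * (i.+1%:R^-1 + harmonic j)) =
      A ^+ 2 * (\sum_(j < N) (i == j)%:R * (`|x - y| * i.+1%:R^-1) +
        \sum_(j < N) 2 * w i j) +
      \sum_(j < N) A ^+ 2 * (2 * (i.+1%:R^-1 + harmonic j)).
    rewrite mulrDr !mulr_sumr -!big_split/=; apply: eq_bigr => j _; rewrite -mulrDr.
    by rewrite -mulrDr.
  rewrite lerD2r ler_wpM2l ?sqr_ge0//; apply: lerD; last first.
    rewrite -mulr_sumr ler_wpM2l// -(big_mkord xpredT (w i)).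
    exact: sum_inv_dist_le.
  rewrite -mulr_suml -[leRHS]mul1r ler_wpM2r//.
  rewrite (bigD1 (Ordinal iN))//= eqxx big1 ?addr0//.
  by move=> j /eqP ji; case: eqP => // ij; case: ji; exact/val_inj.
apply: (@le_trans _ _ (\sum_(i < N) A ^+ 2 *
    (`|x - y| * i.+1%:R^-1 + 2 * (2 * H + N%:R * i.+1%:R^-1 + H)))).
  by apply: ler_sum => i _; exact: row.
have sumH : \sum_(i < N) (i.+1%:R^-1 : R) = H by rewrite /H /series/= big_mkord.
rewrite (eq_bigr (fun i : 'I_N => A ^+ 2 * (`|x - y| + 2 * N%:R) * i.+1%:R^-1 +
    A ^+ 2 * (6 * H))); last first.
  by move=> i _; move: (i.+1%:R^-1 : R) (N%:R : R) `|x - y| => u v z; ring.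
rewrite big_split/= -mulr_sumr sumH sumr_const card_ord -[A ^+ 2 * (6 * H) *+ N]mulr_natl.
move: (N%:R : R) `|x - y| => u v.
by rewrite le_eqVlt; apply/orP; left; apply/eqP; ring.
Qed.

End MeanSquare.

(** * The alternating series on horizontal lines *)

Section EtaAnalytic.
Variable R : realType.

(* Taylor coefficients at [sg] of [x |-> p * exp (- x * al) - q * exp (- x * be)]. *)
Definition pairc (p q al be sg : R) (k : nat) : R :=
  (p * expR (- (sg * al)) * (- al) ^+ k - q * expR (- (sg * be)) * (- be) ^+ k) / k`!%:R.

Lemma has_pseries_expR (al x : R) :
  has_pseries (fun k => (- al) ^+ k / k`!%:R) x (expR (- (x * al))).
Proof.
rewrite /has_pseries (_ : (fun k => _) = exp_coeff (- (x * al))).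
  by rewrite /expR; exact: is_cvg_series_exp_coeff.
apply/funext => k; have e : - (x * al) = (- al) * x by rewrite mulNr mulrC.
by rewrite e /exp_coeff [RHS]/= exprMn [LHS]mulrAC.
Qed.

Lemma ranalytic_expR (al x0 : R) : ranalytic (fun x => expR (- (x * al))) x0.
Proof.
(* The summand with factor 0 gives the coefficients the shape of a linear combination, as
   [has_pseries_lc] produces it. *)
exists (fun k => expR (- (x0 * al)) * ((- al) ^+ k / k`!%:R) + 0 * ((- al) ^+ k / k`!%:R)), 1.
split => // x _; rewrite mulrDl opprD expRD.
have := @has_pseries_lc _ _ _ (expR (- (x0 * al))) 0 x _ _ (@has_pseries_expR al x) (@has_pseries_expR al x).
by rewrite mul0r addr0.
Qed.

Lemma ranalytic_cst (k x0 : R) : ranalytic (fun=> k) x0.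
Proof.
have := @ranalytic_lc _ _ _ k 0 x0 (ranalytic_expR 0 x0) (ranalytic_expR 0 x0).
rewrite (_ : (fun x : R => _) = fun=> k)//.
by apply/funext => x; rewrite mulr0 oppr0 expR0 mulr1 mul0r addr0.
Qed.

Lemma has_pseries_pair (p q al be sg x : R) :
  has_pseries (pairc p q al be sg) x
    (p * expR (- ((sg + x) * al)) - q * expR (- ((sg + x) * be))).
Proof.
have := @has_pseries_lc _ _ _ (p * expR (- (sg * al))) (- (q * expR (- (sg * be)))) x _ _
  (@has_pseries_expR al x) (@has_pseries_expR be x).
rewrite (_ : (fun k => _) = pairc p q al be sg); last first.
  by apply/funext => k; rewrite /pairc; ring.
by rewrite !mulrDl !opprD !expRD !mulrA mulNr.
Qed.

Lemma expR_sub_le (x y : R) : x <= y -> expR y - expR x <= (y - x) * expR y.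
Proof.
move=> xy; have := expR_ge1Dx (x - y).
rewrite -(ler_pM2r (expR_gt0 y)) -expRD subrK; lra.
Qed.

Lemma sum_expR_le (z : R) K : 0 <= z -> \sum_(0 <= k < K) z ^+ k / k`!%:R <= expR z.
Proof.
move=> z0; rewrite /expR; apply: (@nondecreasing_cvgn_le _ (series (exp_coeff z))).
  by apply: nondecreasing_series => k _ _; exact: exp_coeff_ge0.
exact: is_cvg_series_exp_coeff.
Qed.

Lemma sum_expRB_le (z w : R) K : 0 <= z -> z <= w ->
  \sum_(0 <= k < K) (w ^+ k - z ^+ k) / k`!%:R <= expR w - expR z.
Proof.
move=> z0 zw; rewrite /expR -limB; try exact: is_cvg_series_exp_coeff.
rewrite (_ : \sum_(0 <= k < K) _ =
    series (fun k => exp_coeff w k - exp_coeff z k) K); last first.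
  by apply: eq_bigr => k _; rewrite /exp_coeff/= mulrBl.
rewrite (_ : _ - _ = series (fun k => exp_coeff w k - exp_coeff z k)); last first.
  by apply/funext => n; rewrite /series/= sumrB.
apply: nondecreasing_cvgn_le.
  apply: nondecreasing_series => k _ _.
  by rewrite /exp_coeff/= -mulrBl mulr_ge0// subr_ge0 lerXn2r// nnegrE// (le_trans z0).
rewrite (_ : series _ = series (exp_coeff w) - series (exp_coeff z)); last first.
  by apply/funext => n; rewrite /series/= sumrB.
by apply: is_cvgB; exact: is_cvg_series_exp_coeff.
Qed.

(** Pairing gains the factor be - al. With ea, eb the exponentials at sg, the difference p ea - q eb
    is split as (p - q) ea + q (ea - eb), which gives [tau] and [sg]; the powers $be^k - al^k$ sum
    to a difference of exponentials, which gives [rho]. *)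
Lemma pairc_sum_le (p q al be sg rho tau : R) K : 0 <= al -> al <= be -> 0 <= rho ->
  rho <= sg -> `|q| <= 1 -> `|p - q| <= tau * (be - al) ->
  \sum_(0 <= k < K) `|pairc p q al be sg k| * rho ^+ k <=
  (tau + sg + rho) * (be - al) * expR (- ((sg - rho) * al)).
Proof.
move=> al0 albe rho0 rhosg q1 pq.
have be0 : 0 <= be by apply: le_trans albe.
set ea := expR (- (sg * al)); set eb := expR (- (sg * be)).
have ea0 : 0 < ea by exact: expR_gt0.
have eb0 : 0 < eb by exact: expR_gt0.
have eba : eb <= ea.
  by rewrite ler_expR lerN2 ler_wpM2l// (le_trans rho0).
have eab : ea - eb <= sg * (be - al) * ea.
  have := @expR_sub_le (- (sg * be)) (- (sg * al)); rewrite lerN2 ler_wpM2l ?(le_trans rho0)//.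
  by move=> /(_ isT); rewrite -/ea -/eb; lra.
have pe : `|p * ea - q * eb| <= (tau + sg) * (be - al) * ea.
  rewrite (_ : _ - _ = (p - q) * ea + q * (ea - eb)); last by ring.
  apply: (le_trans (ler_normD _ _)).
  rewrite !normrM (gtr0_norm ea0) (@ger0_norm _ (ea - eb)) ?subr_ge0//.
  have h1 : `|p - q| * ea <= tau * (be - al) * ea by rewrite ler_wpM2r// ltW.
  have h2 : `|q| * (ea - eb) <= 1 * (ea - eb) by rewrite ler_wpM2r// subr_ge0.
  by lra.
have ck k : `|pairc p q al be sg k| * rho ^+ k <=
    (tau + sg) * (be - al) * ea * ((rho * al) ^+ k / k`!%:R) +
    eb * (((rho * be) ^+ k - (rho * al) ^+ k) / k`!%:R).
  have f0 : (0 : R) < k`!%:R by rewrite ltr0n fact_gt0.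
  have ak : 0 <= al ^+ k by exact: exprn_ge0.
  have abk : al ^+ k <= be ^+ k by rewrite lerXn2r// nnegrE.
  have -> : pairc p q al be sg k =
      (-1) ^+ k * ((p * ea - q * eb) * al ^+ k - q * eb * (be ^+ k - al ^+ k)) / k`!%:R.
    by rewrite /pairc -/ea -/eb (exprNn al) (exprNn be); ring.
  rewrite normrM normfV (gtr0_norm f0) normrM normrX normrN1 expr1n mul1r.
  rewrite mulrAC !exprMn.
  have -> : (tau + sg) * (be - al) * ea * (rho ^+ k * al ^+ k / k`!%:R) +
    eb * ((rho ^+ k * be ^+ k - rho ^+ k * al ^+ k) / k`!%:R) =
    ((tau + sg) * (be - al) * ea * al ^+ k + eb * (be ^+ k - al ^+ k)) * rho ^+ k / k`!%:R.
    by ring.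
  rewrite ler_wpM2r ?invr_ge0 ?(ltW f0)// ler_wpM2r ?exprn_ge0//.
  apply: (le_trans (ler_normB _ _)); rewrite !normrM.
  rewrite (ger0_norm ak) (gtr0_norm eb0) (@ger0_norm _ (be ^+ k - al ^+ k)) ?subr_ge0//.
  apply: lerD; first by rewrite ler_wpM2r.
  by rewrite ler_wpM2r ?subr_ge0// -[leRHS]mul1r ler_wpM2r// ltW.
apply: (@le_trans _ _ (\sum_(0 <= k < K)
   ((tau + sg) * (be - al) * ea * ((rho * al) ^+ k / k`!%:R) +
    eb * (((rho * be) ^+ k - (rho * al) ^+ k) / k`!%:R)))).
  by apply: ler_sum => k _; exact: ck.
rewrite big_split/= -!mulr_sumr.
have c0 : 0 <= (tau + sg) * (be - al) * ea by apply: le_trans pe.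
have h1 := ler_wpM2l c0 (@sum_expR_le (rho * al) K (mulr_ge0 rho0 al0)).
have h2 := ler_wpM2l (ltW eb0) (@sum_expRB_le (rho * al) (rho * be) K (mulr_ge0 rho0 al0)
  (ler_wpM2l rho0 albe)).
have h3 := ler_wpM2l (ltW eb0) (@expR_sub_le (rho * al) (rho * be) (ler_wpM2l rho0 albe)).
have e1 : ea * expR (rho * al) = expR (- ((sg - rho) * al)).
  by rewrite -expRD; congr expR; ring.
have e2 : eb * expR (rho * be) <= expR (- ((sg - rho) * al)).
  rewrite -expRD ler_expR (_ : _ + _ = - ((sg - rho) * be)); last by ring.
  rewrite lerN2.
  by rewrite ler_wpM2l// subr_ge0.
have h4 : rho * (be - al) * (eb * expR (rho * be)) <=
    rho * (be - al) * expR (- ((sg - rho) * al)).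
  by rewrite ler_wpM2l// mulr_ge0// subr_ge0.
rewrite -e1 in h4 *.
move: h1 h2 h3 h4; move: (\sum_(0 <= k < K) _) (\sum_(0 <= k < K) _) (expR _) (expR _).
by move=> s1 s2 x1 x2; lra.
Qed.

End EtaAnalytic.

(** * Convergence and analyticity of the alternating series summed in pairs *)

Section Eta.
Variable R : realType.
Local Notation l := (@lnS R).

(** Comparison with a telescoping series: with $T_m = e^{-\delta l_{2m}}$, the gap times $\delta
    T_{m+1}$ is at most $T_m - T_{m+1}$, and $T_m \le e^{2\delta} T_{m+1}$ because consecutive even
    frequencies differ by at most 2. *)
Lemma cvg_eta_majorant (delta : R) : 0 < delta ->
  cvgn (series (fun m => (l m.*2.+1 - l m.*2) * expR (- (delta * l m.*2)))).
Proof.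
move=> d0; pose T m := expR (- (delta * l m.*2)).
have step m : (l m.*2.+1 - l m.*2) * T m <= expR (2 * delta) / delta * (T m - T m.+1).
  have h2 : l m.+1.*2 - l m.*2 <= 2.
    have lem : (m.*2 <= m.+1.*2)%N by rewrite leq_double.
    apply: (le_trans (@lnS_sub_le R _ _ lem)).
    rewrite doubleS -addn2 addKn ler_pdivrMr ?ltr0n// -natrM ler_nat; lia.
  have h1 : l m.*2.+1 <= l m.+1.*2 by apply: ler_lnS; rewrite doubleS.
  have h3 : delta * (l m.+1.*2 - l m.*2) * T m.+1 <= T m - T m.+1.
    have e := expR_ge1Dx (delta * (l m.+1.*2 - l m.*2)).
    have f : expR (delta * (l m.+1.*2 - l m.*2)) * T m.+1 = T m.
      by rewrite /T -expRD; congr expR; ring.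
    have := ler_wpM2r (expR_ge0 (- (delta * l m.+1.*2))) e; rewrite -/(T m.+1) f.
    by move: (T m) (T m.+1) (l m.+1.*2) => x y z; lra.
  have h4 : T m <= expR (2 * delta) * T m.+1.
    rewrite /T -expRD ler_expR.
    have := ler_wpM2l (ltW d0) h2; lra.
  have h5 : 0 <= l m.*2.+1 - l m.*2 by rewrite subr_ge0 ler_lnS.
  have E0 : 0 < expR (2 * delta) by exact: expR_gt0.
  apply: (le_trans (ler_wpM2l h5 h4)).
  rewrite mulrCA -mulrA ler_pM2l// ler_pdivlMl//.
  apply: le_trans h3; rewrite mulrA ler_pM2r ?expR_gt0// ler_pM2l//; lra.
apply: nondecreasing_is_cvgn.
  apply: nondecreasing_series => m _ _.
  by rewrite mulr_ge0 ?expR_ge0// subr_ge0 ler_lnS.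
exists (expR (2 * delta) / delta * T 0%N) => _ [n _ <-].
rewrite /series/=; apply: (@le_trans _ _ (\sum_(0 <= m < n)
   expR (2 * delta) / delta * (T m - T m.+1))).
  by apply: ler_sum => m _; exact: step.
have c0 : 0 <= expR (2 * delta) / delta by rewrite divr_ge0 ?expR_ge0// ltW.
rewrite -mulr_sumr ler_wpM2l//.
under eq_bigr do rewrite -opprB.
rewrite sumrN telescope_sumr// opprB gerBl; exact: expR_ge0.
Qed.

(** In the application [p] is $\cos(t \ln(k+1))$ or $-\sin(t \ln(k+1))$, and [tau] is |t|. *)
Variables (p : R ^nat) (tau : R).
Hypothesis p_le1 : forall k, `|p k| <= 1.
Hypothesis p_lip : forall k, `|p k - p k.+1| <= tau * (l k.+1 - l k).

(** Consecutive terms of the alternating series are taken together because the series of pairs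
    converges absolutely for sg > 0. *)
Definition pair_term (sg : R) (m : nat) : R :=
  p m.*2 * expR (- (sg * l m.*2)) - p m.*2.+1 * expR (- (sg * l m.*2.+1)).

Definition pair_sum (sg : R) : R := limn (series (pair_term sg)).

Lemma pair_sum_cvg (sg : R) : 0 < sg -> series (pair_term sg) @ \oo --> pair_sum sg.
Proof.
move=> sg0; apply: (@cvg_series_dominated _ _
  (fun m => (tau + sg) * ((l m.*2.+1 - l m.*2) * expR (- (sg * l m.*2))))); last first.
  apply: is_cvg_seriesZ; exact: cvg_eta_majorant.
(* With rho = 0 and K = 1 only the constant coefficient remains, which is the pair itself. *)
move=> m; have := @pairc_sum_le _ (p m.*2) (p m.*2.+1) (l m.*2) (l m.*2.+1) sg 0 tau 1
  (lnS_ge0 _ _) (ler_lnS _ (leqnSn _)) (lexx _) (ltW sg0) (p_le1 _) (p_lip _).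
rewrite big_nat1 expr0 mulr1 /pairc !expr0 !mulr1 fact0 divr1 subr0 addr0.
by rewrite -mulrA.
Qed.

Lemma pair_sum_ranalytic (sg : R) : 2^-1 <= sg -> ranalytic pair_sum sg.
Proof.
(* The radius 1/4 leaves sg - rho >= 1/4, so the decay exponent of the majorant can be taken equal
   to [rho]. *)
move=> sg2; pose rho : R := 4^-1; have rho0 : 0 < rho by rewrite invr_gt0.
have rhoE : rho = 4^-1 by [].
pose M m := (tau + sg + rho) * ((l m.*2.+1 - l m.*2) * expR (- (rho * l m.*2))).
have tau0 : 0 <= tau * (l 1 - l 0) by apply: le_trans (p_lip 0).
have [||a Ha] := @pseries_sum _
  (fun m => pairc (p m.*2) (p m.*2.+1) (l m.*2) (l m.*2.+1) sg) M rho rho0.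
- move=> m K; apply: le_trans (@pairc_sum_le _ _ _ _ _ sg rho tau K
    (lnS_ge0 _ _) (ler_lnS _ (leqnSn _)) (ltW rho0) _ (p_le1 _) (p_lip _)) _; first by lra.
  have l10 : 0 < l 1 - l 0 by rewrite /lnS ln1 subr0 ln_gt0// ltr1n.
  have tau0' : 0 <= tau by rewrite -(pmulr_lge0 _ l10).
  rewrite /M mulrA ler_wpM2l ?mulr_ge0 ?subr_ge0 ?ler_lnS//; first by lra.
  by rewrite ler_expR lerN2 ler_wpM2r ?lnS_ge0//; lra.
- by apply: is_cvg_seriesZ; exact: cvg_eta_majorant.
exists a, rho; split => // x xr; apply: (Ha x (pair_term (sg + x))) => //.
  by move=> m; exact: has_pseries_pair.
by apply: pair_sum_cvg; move: xr; rewrite ler_norml => /andP[]; lra.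
Qed.

End Eta.

(** * The tail of the alternating series on the critical line *)

Section CriticalLine.
Variable R : realType.
Local Notation l := (@lnS R).

(** Discrete form of the Kusmin-Landau argument: Abel summation leaves two boundary terms, at most
    2Y together, and a sum weighted by the variation of b, which telescopes to at most Y times
    [d N]. *)
Lemma summation_by_parts_tail (K : numFieldType) (y b d : nat -> K) (Y : K) (N M : nat) :
  (N <= M)%N ->
  (forall n, (N <= n)%N -> y n = (y n - y n.+1) * b n) ->
  (forall n, (N <= n)%N -> `|b n| <= 1) ->
  (forall n, (N <= n)%N -> `|b n.+1 - b n| <= d n - d n.+1) ->
  (forall n, (N <= n)%N -> `|y n| <= Y) -> (forall n, 0 <= d n) ->
  `|\sum_(N <= n < M) y n| <= Y * (2 + d N).
Proof.
move=> NM yb b1 bd yY d0.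
have Y0 : 0 <= Y by apply: le_trans (yY N _).
have -> : \sum_(N <= n < M) y n =
    b N * y N - b M * y M + \sum_(N <= n < M) (b n.+1 - b n) * y n.+1.
  elim: M NM => [|M IH]; first by rewrite leqn0 => /eqP ->; rewrite !big_geq// addr0 subrr.
  rewrite leq_eqVlt => /predU1P[->|]; first by rewrite !big_geq// addr0 subrr.
  rewrite ltnS => NM; rewrite !big_nat_recr//= IH//.
  (* Subtracting this zero turns the induction step into a polynomial identity. *)
  have e : y M - (y M - y M.+1) * b M = 0 by rewrite -yb// subrr.
  by rewrite -[LHS]subr0 -e; ring.
apply: le_trans (ler_normD _ _) _.
have h1 n : (N <= n)%N -> `|b n * y n| <= Y.
  by move=> Nn; rewrite normrM -[Y]mul1r ler_pM// ?b1// yY.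
have h2 : `|b N * y N - b M * y M| <= Y + Y.
  by apply: le_trans (ler_normB _ _) _; apply: lerD; apply: h1.
have h3 : `|\sum_(N <= n < M) (b n.+1 - b n) * y n.+1| <= Y * d N.
  apply: le_trans (ler_norm_sum _ _ _) _.
  apply: (@le_trans _ _ (\sum_(N <= n < M) Y * (d n - d n.+1))).
    rewrite !big_nat; apply: ler_sum => n /andP[Nn _].
    rewrite normrM mulrC ler_pM// ?bd// yY//; exact: leqW.
  rewrite -mulr_sumr ler_wpM2l//.
  under eq_bigr do rewrite -opprB.
  by rewrite sumrN telescope_sumr// opprB gerBl.
by rewrite mulrDr [Y * 2]mulr_natr mulr2n; apply: lerD.
Qed.

Lemma lipschitz1 (f df : R -> R) (x y : R) : (forall x : R, is_derive x 1 f (df x)) ->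
  (forall x, `|df x| <= 1) -> `|f x - f y| <= `|x - y|.
Proof.
move=> fd df1; wlog xy : x y / x <= y.
  by move=> W; have [/W//|/ltW/W] := leP x y; rewrite distrC [leRHS]distrC.
have h1 : x - f x <= y - f y.
  apply: (@ge0_derive_le _ (fun x => x - f x) _ x y
     (fun z => is_deriveB (is_derive_id z (1 : R)) (fd z))) => // z.
  by have := df1 z; rewrite ler_norml => /andP[]; lra.
have h2 : x + f x <= y + f y.
  apply: (@ge0_derive_le _ (fun x => x + f x) _ x y
     (fun z => is_deriveD (is_derive_id z (1 : R)) (fd z))) => // z.
  by have := df1 z; rewrite ler_norml => /andP[]; lra.
by rewrite [leRHS]distrC (@ger0_norm _ (y - x)) ?subr_ge0// ler_norml; apply/andP; split; lra.
Qed.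

Lemma cos_lipschitz (x y : R) : `|cos x - cos y| <= `|x - y|.
Proof.
apply: (@lipschitz1 cos (fun x => - sin x)) => z.
by rewrite normrN ler_norml sin_geN1 sin_le1.
Qed.

Lemma sin_lipschitz (x y : R) : `|sin x - sin y| <= `|x - y|.
Proof.
apply: (@lipschitz1 sin cos) => z.
by rewrite ler_norml cos_geN1 cos_le1.
Qed.

Lemma expRN_lipschitz (x y : R) : 0 <= x -> 0 <= y ->
  `|expR (- x) - expR (- y)| <= `|x - y|.
Proof.
wlog xy : x y / x <= y.
  move=> W x0 y0; have [/W->//|/ltW/W h] := leP x y.
  by rewrite distrC [leRHS]distrC h.
move=> x0 y0; rewrite [leRHS]distrC !ger0_norm ?subr_ge0// ?ler_expR ?lerN2//.
have := @expR_sub_le _ (- y) (- x); rewrite lerN2 => /(_ xy).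
have : expR (- x) <= 1 by rewrite -expR0 ler_expR; lra.
have : 0 <= y - x by lra.
by move: (expR (- x)) (expR (- y)) => u v h1 h2 h3; nra.
Qed.

Lemma cexpD (z w : R[i]) : cexp (z + w) = cexp z * cexp w.
Proof.
case: z w => [a b] [c d]; rewrite /cexp/= expRD cosD sinD; simpc.
by apply/eqP; rewrite eq_complex/=; apply/andP; split; apply/eqP; ring.
Qed.

Lemma norm_cexp (z : R[i]) : `|cexp z| = (expR (complex.Re z))%:C.
Proof.
case: z => a b; rewrite /cexp/= normrM normc_def/= [X in _ * X]normc_def/=.
rewrite cos2Dsin2 sqrtr1 mulr1 expr0n/= addr0 sqrtr_sqr.
by rewrite ger0_norm// expR_ge0.
Qed.

(** The term $(n+1)^{-s}$ at s = sg + it, in the form used by [is_riemann_zeta]. *)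
Definition dterm (sg t : R) (n : nat) : R[i] := cexp (- (sg +i* t) * (l n)%:C).

Lemma dtermE sg t n : dterm sg t n =
  (expR (- (sg * l n)) * cos (t * l n)) +i* (- (expR (- (sg * l n)) * sin (t * l n))).
Proof.
have -> : dterm sg t n = cexp ((- (sg * l n)) +i* (- (t * l n))).
  rewrite /dterm; congr cexp; apply/eqP; rewrite eq_complex/=.
  by apply/andP; split; apply/eqP; ring.
rewrite /cexp/= cosN sinN; apply/eqP; rewrite eq_complex/=.
by apply/andP; split; apply/eqP; ring.
Qed.

(** Index 2n + 1 carries the integer 2n + 2, twice the integer carried by index n. *)
Lemma lnSM n : l n.*2.+1 = l 1 + l n.
Proof.
rewrite /lnS -lnM ?posrE ?ltr0n// -natrM; congr (ln _%:R); lia.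
Qed.

Lemma dterm_odd sg t n : dterm sg t n.*2.+1 = dterm sg t 1 * dterm sg t n.
Proof. by rewrite /dterm lnSM rmorphD/= mulrDr cexpD. Qed.

(** Truncated form of $\eta = (1 - 2^{1-s}) \zeta$: subtracting the even terms twice from the full
    sum up to 2N changes their sign, and they are $2^{-s}$ times the first N terms. *)
Lemma paired_dirichlet sg t N :
  \sum_(0 <= m < N) (dterm sg t m.*2 - dterm sg t m.*2.+1) =
  series (dterm sg t) N.*2 - 2 * dterm sg t 1 * series (dterm sg t) N.
Proof.
elim: N => [|N IH]; first by rewrite /series/= !big_geq//; ring.
rewrite big_nat_recr//= IH /series/= doubleS !big_nat_recr//= dterm_odd; ring.
Qed.

Definition alt_coef (n : nat) : R := (-1) ^+ n * expR (- (2^-1 * l n)).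

Lemma alt_dtermE t N M : \sum_(N <= n < M) (-1) ^+ n * dterm 2^-1 t n =
  (\sum_(N <= n < M) alt_coef n * cos (t * l n)) +i*
  (- \sum_(N <= n < M) alt_coef n * sin (t * l n)).
Proof.
rewrite -sumrN; apply/esym; elim/big_ind3 : _ => //.
- by move=> x1 y1 z1 x2 y2 z2 <- <-; simpc.
move=> n _; rewrite dtermE /alt_coef; have -> : (-1) ^+ n = ((-1) ^+ n : R)%:C :> R[i].
  by rewrite rmorphXn rmorphN rmorph1.
by apply/eqP; rewrite eq_complex/=; apply/andP; split; apply/eqP; ring.
Qed.

Lemma norm_complex_le (z : R[i]) (x y : R) :
  `|complex.Re z| <= x -> `|complex.Im z| <= y -> `|z| <= (x + y)%:C.
Proof.
move=> zx zy; rewrite normc_def lecR -[leRHS]ger0_norm; last first.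
  by apply: addr_ge0; [apply: le_trans zx|apply: le_trans zy].
rewrite -sqrtr_sqr ler_sqrt ?sqr_ge0// sqrrD.
have := @lerXn2r R 2 _ _ (normr_ge0 _) (le_trans (normr_ge0 _) zx) zx.
have := @lerXn2r R 2 _ _ (normr_ge0 _) (le_trans (normr_ge0 _) zy) zy.
rewrite !real_normK ?num_real//.
have : 0 <= x * y by apply: mulr_ge0; [apply: le_trans zx|apply: le_trans zy].
by lra.
Qed.

(** Consecutive terms satisfy $y_n - y_{n+1} = y_n (1 + r_n)$ with $\Re(1 + r_n) \ge 1$, so
    summation by parts applies with $b_n = 1/(1 + r_n)$ and Y = 1; the variation of b is controlled
    by that of the decreasing gaps [del]. *)
Lemma dterm_tail t N M : (N <= M)%N -> `|t| <= N%:R ->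
  `|\sum_(N <= n < M) (-1) ^+ n * dterm 2^-1 t n| <= 4.
Proof.
move=> NM tN.
pose del n := l n.+1 - l n.
have del0 n : 0 <= del n by rewrite subr_ge0 ler_lnS.
have del_le n : del n <= n.+1%:R^-1.
  by have := @lnS_sub_le R n n.+1 (leqnSn n); rewrite subSnn div1r.
have del_dec n : del n.+1 <= del n.
  have := @lnS_sub_le R n.+1 n.+2 (leqnSn _); rewrite subSnn div1r => h.
  by apply: (le_trans h); have := @lnS_sub_ge R n n.+1 (leqnSn n); rewrite subSnn div1r.
(* [r n] is the ratio of consecutive terms; for [n >= |t|] its argument is at
   most 1 in absolute value, which keeps [1 + r n] away from 0. *)
pose r n := cexp (- (2^-1 +i* t) * (del n)%:C) : R[i].
have rE n : r n = (expR (- (2^-1 * del n)) * cos (t * del n)) +i*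
    (- (expR (- (2^-1 * del n)) * sin (t * del n))).
  have -> : r n = cexp ((- (2^-1 * del n)) +i* (- (t * del n))).
    rewrite /r; congr cexp; apply/eqP; rewrite eq_complex/=.
    by apply/andP; split; apply/eqP; ring.
  rewrite /cexp/= cosN sinN; apply/eqP; rewrite eq_complex/=.
  by apply/andP; split; apply/eqP; ring.
have xr n : dterm 2^-1 t n.+1 = r n * dterm 2^-1 t n.
  by rewrite /dterm /r -cexpD -mulrDr -rmorphD/= subrK.
have Re1 n : (N <= n)%N -> 1 <= complex.Re (1 + r n).
  move=> Nn; rewrite rE/= lerDl mulr_ge0 ?expR_ge0//.
  have n0 : (0 : R) < n.+1%:R by rewrite ltr0n.
  have : `|t * del n| <= 1.
    rewrite normrM (ger0_norm (del0 n)) -(@mulfV _ (n.+1%:R : R)) ?gt_eqF//.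
    apply: ler_pM => //; apply: (le_trans tN); rewrite ler_nat; exact: leqW.
  have := @pi_ge2 R; rewrite ler_norml => p2 /andP[? ?].
  by apply: cos_ge0_pihalf; apply/andP; split; lra.
have norm1 n : (N <= n)%N -> 1 <= `|1 + r n|.
  move=> /Re1 h; apply: le_trans (normc_ge_Re _); rewrite -[1]/((1 : R)%:C) lecR.
  by apply: (le_trans h); exact: ler_norm.
have unit1 n : (N <= n)%N -> 1 + r n != 0.
  by move=> /norm1 h; rewrite -normr_gt0; apply: lt_le_trans h.
have rlip n : `|r n.+1 - r n| <= ((1 + 2 * `|t|) * (del n - del n.+1))%:C.
  have dd : `|del n.+1 - del n| = del n - del n.+1.
    by rewrite distrC ger0_norm// subr_ge0.
  have e1 m : expR (- (2^-1 * del m)) <= 1.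
    by rewrite -expR0 ler_expR oppr_le0 mulr_ge0.
  have comp (f : R -> R) : (forall x, `|f x| <= 1) -> (forall x y, `|f x - f y| <= `|x - y|) ->
     `|expR (- (2^-1 * del n.+1)) * f (t * del n.+1) -
       expR (- (2^-1 * del n)) * f (t * del n)| <= (2^-1 + `|t|) * (del n - del n.+1).
    move=> f1 flip.
    rewrite (_ : _ - _ = (expR (- (2^-1 * del n.+1)) - expR (- (2^-1 * del n))) * f (t * del n.+1)
       + expR (- (2^-1 * del n)) * (f (t * del n.+1) - f (t * del n))); last by ring.
    apply: le_trans (ler_normD _ _) _; rewrite !normrM mulrDl; apply: lerD.
      rewrite -[leRHS]mulr1; apply: ler_pM => //.
      apply: le_trans (expRN_lipschitz _ _) _; rewrite ?mulr_ge0//.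
      by rewrite -mulrBr normrM dd ger0_norm.
    rewrite -[leRHS]mul1r; apply: ler_pM => //.
      by rewrite ger0_norm ?expR_ge0.
    by apply: le_trans (flip _ _) _; rewrite -mulrBr normrM dd.
  (* One half of the bound goes to the real part, the other to the imaginary part. *)
  rewrite (_ : (1 + _) * _ = (2^-1 + `|t|) * (del n - del n.+1) +
     (2^-1 + `|t|) * (del n - del n.+1)); last by field.
  apply: norm_complex_le; rewrite !rE/=.
    by apply: comp => [x|]; [rewrite ler_norml cos_geN1 cos_le1 | exact: cos_lipschitz].
  rewrite -opprD normrN.
  by apply: comp => [x|]; [rewrite ler_norml sin_geN1 sin_le1 | exact: sin_lipschitz].
have bb n : (N <= n)%N -> `|(1 + r n)^-1| <= 1.
  by move=> Nn; rewrite normfV invf_le1 ?norm1// normr_gt0 unit1.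
apply: le_trans (@summation_by_parts_tail _ _ (fun n => (1 + r n)^-1)
  (fun n => ((1 + 2 * `|t|) * del n)%:C) 1 N M NM _ _ _ _ _) _.
- move=> n Nn; rewrite exprS xr mulN1r mulNr opprK.
  rewrite (_ : _ + _ = (-1) ^+ n * dterm 2^-1 t n * (1 + r n)); last by ring.
  by rewrite mulfK// unit1.
- exact: bb.
- move=> n Nn; have Nn' := leqW Nn.
  have -> : (1 + r n.+1)^-1 - (1 + r n)^-1 = (r n - r n.+1) * ((1 + r n.+1)^-1 * (1 + r n)^-1).
    by field; rewrite !unit1.
  rewrite -rmorphB/= -mulrBr; apply: le_trans (rlip n); rewrite normrM distrC.
  by rewrite -[leRHS]mulr1 ler_wpM2l// normrM mulr_ile1// bb.
- move=> n Nn; rewrite normrM normrX normrN1 expr1n mul1r norm_cexp.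
  rewrite -[leRHS]/((1 : R)%:C) lecR -expR0 ler_expR/= mulr0 subr0 mulNr oppr_le0.
  by rewrite mulr_ge0// lnS_ge0.
- by move=> n; rewrite ler0c mulr_ge0// addr_ge0// mulr_ge0.
rewrite mul1r.
have -> : 4 = (2 + 2 : R)%:C :> R[i] by rewrite rmorphD/= rmorph_nat -natrD.
have -> : 2 = (2 : R)%:C :> R[i] by rewrite rmorph_nat.
rewrite -rmorphD/= lecR lerD2l.
have N0 : (0 : R) < N.+1%:R by rewrite ltr0n.
(* The variation bound at N is at most (1 + 2N)/(N + 1) <= 2; with the boundary terms this makes
   4. *)
apply: (@le_trans _ _ ((1 + 2 * N%:R) * N.+1%:R^-1)).
  by apply: ler_pM => //; rewrite lerD2l ler_wpM2l.
by rewrite ler_pdivrMr// -natr1; lra.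
Qed.

End CriticalLine.

(** * Bounding zeta by a Dirichlet polynomial *)

Section ZetaBound.
Variable R : realType.
Local Notation l := (@lnS R).

Lemma cvg_ReIm (u : nat -> R[i]) (z : R[i]) : u @ \oo --> z ->
  (fun n => complex.Re (u n)) @ \oo --> complex.Re z /\
  (fun n => complex.Im (u n)) @ \oo --> complex.Im z.
Proof.
move=> uz; have cl (e : R) : 0 < e -> \forall n \near \oo, `|z - u n| < e%:C.
  move=> e0; have : (0 : R[i]) < e%:C by rewrite ltcR.
  by move/cvgrPdist_lt : uz; apply.
have ReIm (w : R[i]) (e : R) : `|w| < e%:C -> `|complex.Re w| < e /\ `|complex.Im w| < e.
  rewrite normc_def ltcR => we; split; apply: le_lt_trans we.
    by rewrite -sqrtr_sqr ler_wsqrtr// lerDl sqr_ge0.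
  by rewrite -sqrtr_sqr ler_wsqrtr// lerDr sqr_ge0.
split; apply/cvgrPdist_lt => e /cl; apply: filterS => n /ReIm[].
  by rewrite raddfB.
by move=> _; rewrite raddfB.
Qed.

Lemma Re_sum (I : Type) (s : seq I) (F : I -> R[i]) :
  complex.Re (\sum_(i <- s) F i) = \sum_(i <- s) complex.Re (F i).
Proof.
elim: s => [|i s IH]; first by rewrite !big_nil.
by rewrite !big_cons -IH; case: (F i) (\sum_(_ <- _) _) => [a b] [c d].
Qed.

Lemma Im_sum (I : Type) (s : seq I) (F : I -> R[i]) :
  complex.Im (\sum_(i <- s) F i) = \sum_(i <- s) complex.Im (F i).
Proof.
elim: s => [|i s IH]; first by rewrite !big_nil.
by rewrite !big_cons -IH; case: (F i) (\sum_(_ <- _) _) => [a b] [c d].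
Qed.

(** Along a horizontal line the increments are real, so the coefficients split into real and
    imaginary parts. Halving the radius passes from an open disc to a closed interval. *)
Lemma analytic_at_ranalytic (f : R[i] -> R[i]) (sg t : R) : analytic_at f (sg +i* t) ->
  ranalytic (fun x => complex.Re (f (x +i* t))) sg /\
  ranalytic (fun x => complex.Im (f (x +i* t))) sg.
Proof.
move=> [a [r [r0 ar]]].
have key (x : R) : `|x| <= r / 2 ->
    has_pseries (fun k => complex.Re (a k)) x (complex.Re (f ((sg + x) +i* t))) /\
    has_pseries (fun k => complex.Im (a k)) x (complex.Im (f ((sg + x) +i* t))).
  move=> xr; have dx : ((sg + x) +i* t) - (sg +i* t) = x%:C :> R[i].
    by apply/eqP; rewrite eq_complex/=; apply/andP; split; apply/eqP; ring.
  have /ar : `|((sg + x) +i* t) - (sg +i* t)| < r%:C.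
    by rewrite dx normc_def/= expr0n/= addr0 sqrtr_sqr ltcR; lra.
  rewrite dx => /cvg_ReIm[hr hi]; split.
    rewrite /has_pseries; move: hr; rewrite (_ : (fun n => complex.Re _) = series
      (fun k => complex.Re (a k) * x ^+ k))//.
    apply/funext => n; rewrite /series/= Re_sum; apply: eq_bigr => k _.
    by rewrite -rmorphXn/=; case: (a k) => u v /=; ring.
  rewrite /has_pseries; move: hi; rewrite (_ : (fun n => complex.Im _) = series
    (fun k => complex.Im (a k) * x ^+ k))//.
  apply/funext => n; rewrite /series/= Im_sum; apply: eq_bigr => k _.
  by rewrite -rmorphXn/=; case: (a k) => u v /=; ring.
split; [exists (fun k => complex.Re (a k)) | exists (fun k => complex.Im (a k))];
  by exists (r / 2); split; [lra | move=> x /key[]].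
Qed.

Lemma cvg_double (u : R ^nat) (y : R) : u @ \oo --> y -> (fun n => u n.*2) @ \oo --> y.
Proof.
move=> uy; apply: (@cvg_comp _ _ _ (fun n => n.*2) u \oo \oo) uy.
apply/cvgnyPge => A; exists A => // n /= An.
by apply: (leq_trans An); rewrite -addnn leq_addr.
Qed.

(** Real and imaginary parts of $(k+1)^{-\mathrm{i}t}$, whence the sign of [sinl]. *)
Definition cosl (t : R) (k : nat) : R := cos (t * l k).
Definition sinl (t : R) (k : nat) : R := - sin (t * l k).

Lemma cosl_le1 t k : `|cosl t k| <= 1.
Proof. by rewrite ler_norml cos_geN1 cos_le1. Qed.

Lemma sinl_le1 t k : `|sinl t k| <= 1.
Proof. by rewrite normrN ler_norml sin_geN1 sin_le1. Qed.

Lemma cosl_lip t k : `|cosl t k - cosl t k.+1| <= `|t| * (l k.+1 - l k).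
Proof.
apply: le_trans (cos_lipschitz _ _) _; rewrite -mulrBr normrM distrC.
by rewrite (@ger0_norm _ (l k.+1 - l k)) ?subr_ge0 ?ler_lnS.
Qed.

Lemma sinl_lip t k : `|sinl t k - sinl t k.+1| <= `|t| * (l k.+1 - l k).
Proof.
rewrite /sinl -opprD normrN; apply: le_trans (sin_lipschitz _ _) _.
rewrite -mulrBr normrM distrC.
by rewrite (@ger0_norm _ (l k.+1 - l k)) ?subr_ge0 ?ler_lnS.
Qed.

Lemma paired_ReIm sg t N :
  complex.Re (\sum_(0 <= m < N) (dterm sg t m.*2 - dterm sg t m.*2.+1)) =
    series (pair_term (cosl t) sg) N /\
  complex.Im (\sum_(0 <= m < N) (dterm sg t m.*2 - dterm sg t m.*2.+1)) =
    series (pair_term (sinl t) sg) N.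
Proof.
rewrite Re_sum Im_sum /series; split; apply: eq_bigr => k _; rewrite !dtermE/=.
  by rewrite /pair_term /cosl; ring.
by rewrite /pair_term /sinl; ring.
Qed.

Variable zeta : R[i] -> R[i].
Hypothesis hzeta : is_riemann_zeta zeta.

(** Limit of [paired_dirichlet] where the Dirichlet series converges, split into real and imaginary
    parts because the continuation is done for real functions of the abscissa. *)
Lemma eta_zeta_gt1 (sg t : R) : 1 < sg ->
  pair_sum (cosl t) sg = (1 - 2 * (expR (- (sg * l 1)) * cosl t 1)) *
    complex.Re (zeta (sg +i* t)) + 2 * (expR (- (sg * l 1)) * sinl t 1) *
    complex.Im (zeta (sg +i* t)) /\
  pair_sum (sinl t) sg = (1 - 2 * (expR (- (sg * l 1)) * cosl t 1)) *
    complex.Im (zeta (sg +i* t)) - 2 * (expR (- (sg * l 1)) * sinl t 1) *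
    complex.Re (zeta (sg +i* t)).
Proof.
move=> sg1; have sg0 : 0 < sg by lra.
set cr := expR _ * cosl _ _; set ci := expR _ * sinl _ _.
have [hr hi] := cvg_ReIm (hzeta.2 (sg +i* t) sg1).
have E N : series (dterm sg t) N.*2 - 2 * (cr +i* ci) * series (dterm sg t) N =
    \sum_(0 <= m < N) (dterm sg t m.*2 - dterm sg t m.*2.+1).
  by rewrite paired_dirichlet dtermE /ci /sinl mulrN.
have two : (2 : R[i]) = 2 +i* 0 by apply/esym; exact: (rmorph_nat (real_complex R)).
split.
  apply: (cvg_unique _ (pair_sum_cvg (cosl_le1 t) (cosl_lip t) sg0)) => //.
  rewrite (_ : series _ = fun N => complex.Re (series (dterm sg t) N.*2) -
     2 * (cr * complex.Re (series (dterm sg t) N) - ci * complex.Im (series (dterm sg t) N))).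
    rewrite (_ : (1 - 2 * cr) * _ + _ = complex.Re (zeta (sg +i* t)) -
      2 * (cr * complex.Re (zeta (sg +i* t)) - ci * complex.Im (zeta (sg +i* t)))); last by ring.
    apply: cvgB; first exact: (cvg_double hr).
    by apply: cvgMl_tmp; apply: cvgB; apply: cvgMl_tmp.
  apply/funext => N; rewrite -(paired_ReIm sg t N).1 -E two.
  by case: (series _ N) (series _ N.*2) => [a b] [c d] /=; ring.
apply: (cvg_unique _ (pair_sum_cvg (sinl_le1 t) (sinl_lip t) sg0)) => //.
rewrite (_ : series _ = fun N => complex.Im (series (dterm sg t) N.*2) -
   2 * (cr * complex.Im (series (dterm sg t) N) + ci * complex.Re (series (dterm sg t) N))).
  rewrite (_ : (1 - 2 * cr) * _ - _ = complex.Im (zeta (sg +i* t)) -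
    2 * (cr * complex.Im (zeta (sg +i* t)) + ci * complex.Re (zeta (sg +i* t)))); last by ring.
  apply: cvgB; first exact: (cvg_double hi).
  by apply: cvgMl_tmp; apply: cvgD; apply: cvgMl_tmp.
apply/funext => N; rewrite -(paired_ReIm sg t N).2 -E two.
by case: (series _ N) (series _ N.*2) => [a b] [c d] /=; ring.
Qed.

(** For t nonzero the horizontal line at height t avoids the pole, so both sides are analytic from
    abscissa 1/2 on, and [ranalytic_zero] brings the identity down from abscissae above 1. *)
Lemma eta_zeta_half (t : R) : t != 0 ->
  (1 - 2 * dterm 2^-1 t 1) * zeta (critical_pt t) =
  pair_sum (cosl t) 2^-1 +i* pair_sum (sinl t) 2^-1.
Proof.
move=> t0.
have za (x : R) : analytic_at zeta (x +i* t).
  by apply: hzeta.1; rewrite eq_complex/= negb_and t0 orbT.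
pose zr x := complex.Re (zeta (x +i* t)); pose zi x := complex.Im (zeta (x +i* t)).
have zra x : ranalytic zr x := (analytic_at_ranalytic (za x)).1.
have zia x : ranalytic zi x := (analytic_at_ranalytic (za x)).2.
pose cr x := expR (- (x * l 1)) * cosl t 1; pose ci x := expR (- (x * l 1)) * sinl t 1.
have lin (k c x : R) : ranalytic (fun x => k * 1 + c * expR (- (x * l 1))) x.
  by apply: ranalytic_lc; [exact: ranalytic_cst | exact: ranalytic_expR].
(* One statement serves both parts: the imaginary one exchanges Re zeta and Im zeta and changes the
   sign of v. *)
have comb (F G E : R -> R) (u v : R) :
    (forall x, ranalytic F x) -> (forall x, ranalytic G x) ->
    (forall x, 2^-1 <= x -> ranalytic E x) ->
    (forall x, 1 < x -> E x = (1 - 2 * (expR (- (x * l 1)) * u)) * F x +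
       2 * (expR (- (x * l 1)) * v) * G x) ->
    E 2^-1 = (1 - 2 * (expR (- (2^-1 * l 1)) * u)) * F 2^-1 +
       2 * (expR (- (2^-1 * l 1)) * v) * G 2^-1.
  move=> Fa Ga Ea EE; apply/eqP; rewrite -subr_eq0; apply/eqP.
  apply: (@ranalytic_zero _ (fun x => E x -
    ((1 - 2 * (expR (- (x * l 1)) * u)) * F x + 2 * (expR (- (x * l 1)) * v) * G x))
    2^-1 1 2).
  - by lra.
  - by lra.
  - move=> x /andP[x2 _].
    have h1 := ranalytic_mul (lin 1 (- 2 * u) x) (Fa x).
    have h2 := ranalytic_mul (lin 0 (2 * v) x) (Ga x).
    have h3 := @ranalytic_lc _ _ _ 1 1 x h1 h2.
    have := @ranalytic_lc _ _ _ 1 (-1) x (Ea x x2) h3.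
    by congr ranalytic; apply/funext => y; ring.
  - by move=> x x1 _; rewrite EE// subrr.
have hr : pair_sum (cosl t) 2^-1 = (1 - 2 * cr 2^-1) * zr 2^-1 + 2 * ci 2^-1 * zi 2^-1.
  apply: comb => // [x|x x1]; last exact: (eta_zeta_gt1 t x1).1.
  exact: (pair_sum_ranalytic (cosl_le1 t) (cosl_lip t)).
have hi : pair_sum (sinl t) 2^-1 = (1 - 2 * cr 2^-1) * zi 2^-1 + 2 * (- ci 2^-1) * zr 2^-1.
  have -> : - ci 2^-1 = expR (- (2^-1 * l 1)) * (- sinl t 1) by rewrite mulrN.
  apply: comb => // [x|x x1]; last by rewrite (eta_zeta_gt1 t x1).2 /zr /zi; ring.
  exact: (pair_sum_ranalytic (sinl_le1 t) (sinl_lip t)).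
have two : (2 : R[i]) = 2 +i* 0 by apply/esym; exact: (rmorph_nat (real_complex R)).
rewrite hr hi dtermE two /critical_pt /zr /zi /cr /ci /sinl /cosl.
case: (zeta _) => a b; apply/eqP; rewrite eq_complex/=.
by apply/andP; split; apply/eqP; ring.
Qed.

(** The tail costs 4 in each of the real and imaginary parts, hence 8; the factor 3 inverts $|1 -
    2^{1-s}| \ge 1/3$. *)
Lemma norm_zeta_half (t : R) (N : nat) : t != 0 -> `|t| <= N%:R ->
  `|zeta (critical_pt t)| <= (3 * (Num.sqrt (trig_sq (@alt_coef R) l N t) + 8))%:C.
Proof.
move=> t0 tN; set PN := \sum_(0 <= n < N) (-1) ^+ n * dterm 2^-1 t n.
have nPN : `|PN| = (Num.sqrt (trig_sq (@alt_coef R) l N t))%:C.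
  by rewrite /PN alt_dtermE normc_def/= /trig_sq !big_mkord sqrrN.
have altE M : \sum_(0 <= m < M) (dterm 2^-1 t m.*2 - dterm 2^-1 t m.*2.+1) =
    \sum_(0 <= n < M.*2) (-1) ^+ n * dterm 2^-1 t n.
  elim: M => [|M IH]; first by rewrite !big_geq.
  have s2 : (-1) ^+ M.*2 = 1 :> R[i] by rewrite -signr_odd odd_double expr0.
  by rewrite big_nat_recr//= IH doubleS !big_nat_recr//= exprS s2; ring.
have close M : (N <= M)%N ->
    `|\sum_(0 <= m < M) (dterm 2^-1 t m.*2 - dterm 2^-1 t m.*2.+1) - PN| <= (4 : R)%:C.
  move=> NM; have NM2 : (N <= M.*2)%N.
    by apply: (leq_trans NM); rewrite -addnn leq_addr.
  rewrite altE /PN (@big_cat_nat _ _ _ N 0 M.*2)//= addrAC subrr add0r.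
  by rewrite (rmorph_nat (real_complex R)); exact: dterm_tail.
have comp M : (N <= M)%N ->
    `|series (pair_term (cosl t) 2^-1) M - complex.Re PN| <= 4 /\
    `|series (pair_term (sinl t) 2^-1) M - complex.Im PN| <= 4.
  move=> /close; rewrite -(paired_ReIm 2^-1 t M).1 -(paired_ReIm 2^-1 t M).2.
  move: (\sum_(_ <= _ < _) _) => w; rewrite -!raddfB normc_def lecR => we.
  split; apply: le_trans we.
    by rewrite -sqrtr_sqr ler_wsqrtr// lerDl sqr_ge0.
  by rewrite -sqrtr_sqr ler_wsqrtr// lerDr sqr_ge0.
have h0 : (0 : R) < 2^-1 by lra.
set eta := pair_sum (cosl t) 2^-1 +i* pair_sum (sinl t) 2^-1.
have eta_le : `|eta| <= (Num.sqrt (trig_sq (@alt_coef R) l N t) + 8)%:C.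
  rewrite -(subrK PN eta) addrC; apply: le_trans (ler_normD _ _) _.
  rewrite nPN rmorphD/= lerD2l (_ : 8 = 4 + 4 :> R); last by ring.
  apply: norm_complex_le; rewrite raddfB/=.
    apply: (cvg_dist_le (pair_sum_cvg (cosl_le1 t) (cosl_lip t) h0)).
    by exists N => // M /= /comp[].
  apply: (cvg_dist_le (pair_sum_cvg (sinl_le1 t) (sinl_lip t) h0)).
  by exists N => // M /= /comp[].
have c3 : (3^-1 : R)%:C <= `|1 - 2 * dterm 2^-1 t 1|.
  have nc : `|dterm 2^-1 t 1| = (expR (- (2^-1 * l 1)))%:C.
    by rewrite /dterm norm_cexp/= mulr0 subr0 mulNr.
  set e := expR _ in nc.
  have e2 : e ^+ 2 = 2^-1.
    rewrite /e expr2 -expRD (_ : _ + _ = - l 1); last by field.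
    by rewrite expRN expR_lnS.
  have e0 : 0 < e by exact: expR_gt0.
  (* Here $e = 2^{-1/2}$ and 1/2 > 4/9; the lower bound 2e - 1 is then at least 1/3. *)
  have e23 : 2 / 3 <= e by nra.
  rewrite distrC; apply: le_trans (lerB_normD _ _); rewrite normrN normr1 normrM nc.
  rewrite (_ : `|2| = (2 : R)%:C); last first.
    by rewrite (rmorph_nat (real_complex R)) ger0_norm.
  by rewrite -rmorphM/= -[X in _ - X]/((1 : R)%:C) -rmorphB/= lecR; lra.
have := eta_zeta_half t0; rewrite -/eta => /(congr1 Num.norm); rewrite normrM => ez.
have : (3^-1 : R)%:C * `|zeta (critical_pt t)| <= `|eta|.
  by rewrite -ez ler_wpM2r.
move=> /le_trans/(_ eta_le); rewrite rmorphM/= => h.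
have three : (3 : R)%:C * (3^-1 : R)%:C = 1 by rewrite -rmorphM/= mulfV.
rewrite -[leLHS]mul1r -three -mulrA ler_wpM2l// ler0c; lra.
Qed.

End ZetaBound.

(** * Cells *)

Section Cells.
Variable R : realType.
Local Notation l := (@lnS R).

Lemma alt_coef_le (i : nat) : `|@alt_coef R i| <= 1 * expR (- (l i / 2)).
Proof.
rewrite /alt_coef normrM normrX normrN1 expr1n !mul1r ger0_norm ?expR_ge0//.
by rewrite mulrC.
Qed.

Lemma alt_coef_lnS_le (N i : nat) : (i < N)%N ->
  `|@alt_coef R i * l i| <= l N * expR (- (l i / 2)).
Proof.
move=> iN; rewrite normrM mulrC; apply: ler_pM => //.
  by rewrite ger0_norm ?lnS_ge0// ler_lnS// ltnW.
by have := alt_coef_le i; rewrite mul1r.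
Qed.

(** [Phi] combines the primitives of $|D|^2$ and $|D'|^2$ as in the Sobolev inequality with $\lambda
    = \ln(N+1)$. The mean value of $|D'|^2$ is larger by $\lambda^2$ but is divided by $\lambda$,
    whence $2\lambda$ in the last bound. *)
Lemma trig_sq_majorant (h : R) (N : nat) : 0 < h -> (0 < N)%N -> exists Phi : R -> R,
  [/\ {homo Phi : x y / x <= y},
      forall a b t, b - a = 3 * h -> a <= t <= b ->
        trig_sq (@alt_coef R) l N t <= Phi b - Phi a &
      forall a b, a <= b ->
        Phi b - Phi a <= ((3 * h)^-1 + 2 * l N) * (1 + l N) * (b - a + 8 * N%:R)].
Proof.
move=> h0 N0; have lN0 : 0 < l N by rewrite ln_gt0// ltr1n.
pose a1 := @alt_coef R; pose a2 i := a1 i * l i.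
pose G := trig_sq_prim a1 l N; pose K := trig_sq_prim a2 l N.
have Gd (x : R) : is_derive x 1 G (trig_sq a1 l N x).
  by apply: trig_sq_prim_derive; exact: lnS_inj.
have Kd (x : R) : is_derive x 1 K (trig_sq a2 l N x).
  by apply: trig_sq_prim_derive; exact: lnS_inj.
have Gm x y : x <= y -> G x <= G y.
  by apply: (ge0_derive_le Gd) => z; exact: trig_sq_ge0.
have Km x y : x <= y -> K x <= K y.
  by apply: (ge0_derive_le Kd) => z; exact: trig_sq_ge0.
have h3 : 0 < (3 * h)^-1 by rewrite invr_gt0 mulr_gt0.
have lV : 0 < (l N)^-1 by rewrite invr_gt0.
pose Phi x := ((3 * h)^-1 + l N) * G x + (l N)^-1 * K x.
have PhiB x y : Phi y - Phi x = ((3 * h)^-1 + l N) * (G y - G x) + (l N)^-1 * (K y - K x).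
  by rewrite /Phi; ring.
exists Phi; split.
- move=> x y xy; rewrite -subr_ge0 PhiB; apply: addr_ge0; apply: mulr_ge0.
  + by rewrite addr_ge0// ltW.
  + by rewrite subr_ge0 Gm.
  + exact: ltW.
  + by rewrite subr_ge0 Km.
- move=> a b t ba tab; rewrite PhiB -ba; apply: (@sobolev_sup _ _ _ _ _ _ _ a b t lN0 _ tab
    (@trig_sq_is_derive _ a1 l N) Gd Kd).
  + by rewrite -subr_gt0 ba mulr_gt0.
  + by move=> x; exact: trig_sq_ge0.
  + by move=> x; exact: trig_sq_ge0.
  + by move=> x; exact: trig_sq_der_le.
- move=> a b ab; rewrite PhiB.
  have H1 : series (@harmonic R) N <= 1 + l N.
    apply: le_trans (series_harmonic_le R N); exact: ler_series_harmonic.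
  have ba : 0 <= b - a + 8 * N%:R by rewrite addr_ge0// ?subr_ge0// mulr_ge0.
  have nba : `|b - a| = b - a by rewrite ger0_norm// subr_ge0.
  have HG : G b - G a <= (1 + l N) * (b - a + 8 * N%:R).
    have := @trig_sq_prim_lnS_dist _ a1 1 N b a ler01 (fun i _ => alt_coef_le i).
    rewrite -/G expr1n mul1r nba => /(le_trans (ler_norm _)) /le_trans; apply.
    by rewrite ler_wpM2r.
  have HK : K b - K a <= (l N) ^+ 2 * ((1 + l N) * (b - a + 8 * N%:R)).
    have := @trig_sq_prim_lnS_dist _ a2 (l N) N b a (ltW lN0) (@alt_coef_lnS_le N).
    rewrite -/K nba => /(le_trans (ler_norm _)) /le_trans; apply.
    by rewrite -mulrA ler_wpM2l ?sqr_ge0// ler_wpM2r.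
  have hG : ((3 * h)^-1 + l N) * (G b - G a) <=
      ((3 * h)^-1 + l N) * ((1 + l N) * (b - a + 8 * N%:R)).
    by rewrite ler_wpM2l// addr_ge0// ltW.
  have hK : (l N)^-1 * (K b - K a) <= l N * ((1 + l N) * (b - a + 8 * N%:R)).
    apply: le_trans (ler_wpM2l (ltW lV) HK) _.
    by rewrite expr2 !mulrA mulVf ?gt_eqF// mul1r.
  apply: le_trans (lerD hG hK) _.
  by rewrite le_eqVlt; apply/orP; left; apply/eqP; ring.
Qed.

(** Each unit increment of u occurs in at most three of the overlapping differences. *)
Lemma sum_shift3_le (u : R ^nat) (K : nat) : nondecreasing_seq u ->
  \sum_(0 <= k < K) (u k.+3 - u k) <= 3 * (u K.+2 - u 0%N).
Proof.
move=> um; have -> : \sum_(0 <= k < K) (u k.+3 - u k) =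
    u K.+2 + u K.+1 + u K - u 0%N - u 1%N - u 2%N.
  elim: K => [|K IH]; first by rewrite big_geq//; ring.
  by rewrite big_nat_recr//= IH; ring.
have := um _ _ (leqnSn K.+1); have := um _ _ (leqnSn K).
by have := um 0%N 1%N isT; have := um 0%N 2%N isT; lra.
Qed.

(* The cell k is [k h, (k + 1) h]; its h-neighbourhood is [(k - 1) h, (k + 2) h]. *)
Lemma cell_majorant (h : R) : 0 < h -> exists C T0 : R, 0 <= C /\ 3 <= T0 /\
  forall T, T0 <= T -> exists (N : nat) (u : R ^nat),
  [/\ nondecreasing_seq u, T + 2 * h <= N%:R,
      forall (k : nat) t, (k%:R - 1) * h <= t <= (k%:R + 2) * h ->
        trig_sq (@alt_coef R) l N t <= u k.+3 - u k &
      forall K : nat, K%:R * h <= T + h -> u K.+2 - u 0%N <= C * T * ln T ^+ 2].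
Proof.
move=> h0; have h3 : 0 < (3 * h)^-1 by rewrite invr_gt0 mulr_gt0.
(* The three factors of C bound those of the last property of [Phi], in units of ln T, ln T and T.
   The choice of T0 ensures ln T >= 1 and T >= 3h + 3, whence N <= 2T and N + 1 <= T^2. *)
exists (((3 * h)^-1 + 4) * 3 * 20), (expR 1 + 3 * h + 3).
split; first by rewrite !mulr_ge0// addr_ge0// ltW.
have e0 : 0 < expR (1 : R) by exact: expR_gt0.
split; first by lra.
move=> T TT; pose N := (Num.trunc (T + 2 * h)).+1.
have T2 : 0 <= T + 2 * h by lra.
have /andP[N1 N2] := truncn_itv T2.
have TN : T + 2 * h <= N%:R by exact: ltW.
have NE : N%:R = (Num.trunc (T + 2 * h))%:R + 1 :> R by rewrite natr1.
have NT : N%:R <= 2 * T by rewrite NE; lra.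
have T0 : 0 < T by lra.
have lT : 1 <= ln T by rewrite -(@expRK _ 1) ler_ln ?posrE//; lra.
have lNT : l N <= 2 * ln T.
  have -> : 2 * ln T = ln (T * T) by rewrite lnM ?posrE//; ring.
  rewrite /lnS ler_ln ?posrE ?mulr_gt0 ?ltr0n//.
  have -> : N.+1%:R = N%:R + 1 :> R by rewrite natr1.
  have T3 : 0 <= (T - 3) * T by rewrite mulr_ge0//; lra.
  by lra.
have [Phi [Pm Pt Pb]] := @trig_sq_majorant h N h0 isT.
have lN0 : 0 <= l N by exact: lnS_ge0.
(* The shift by -1 makes $u_{k+3} - u_k$ the increment of [Phi] over the h-neighbourhood of the cell
   k. *)
exists N, (fun k => Phi ((k%:R - 1) * h)); split => //.
- move=> i j ij; apply: Pm; rewrite ler_pM2r// lerD2r ler_nat//.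
- move=> k t kt; apply: Pt.
    by rewrite -addn3 natrD; ring.
  by rewrite -addn3 natrD (_ : k%:R + 3 - 1 = k%:R + 2 :> R)//; ring.
- move=> K KT; have e1 : (K.+2%:R - 1) * h = K%:R * h + h by rewrite -addn2 natrD; ring.
  have Kh : 0 <= K%:R * h by rewrite mulr_ge0// ltW.
  rewrite e1 mulr0n sub0r mulN1r; apply: le_trans (Pb _ _ _) _; first by lra.
  have b1 : (3 * h)^-1 + 2 * l N <= ((3 * h)^-1 + 4) * ln T by nra.
  have b2 : 1 + l N <= 3 * ln T by lra.
  have b3 : K%:R * h + h - - h + 8 * N%:R <= 20 * T by lra.
  have N0 : (0 : R) <= N%:R by [].
  apply: (@le_trans _ _ ((((3 * h)^-1 + 4) * ln T) * (3 * ln T) * (20 * T))); last first.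
    by rewrite le_eqVlt; apply/orP; left; apply/eqP; ring.
  apply: ler_pM => //.
  + by rewrite mulr_ge0// addr_ge0// ?mulr_ge0// ltW.
  + by lra.
  + apply: ler_pM => //; last by lra.
    by rewrite addr_ge0// ?mulr_ge0// ltW.
Qed.

(** Here [B] is arbitrary: the set is a union of intervals of positive length, each containing a
    rational, and grouping them by rationals leaves a countable union of intervals. *)
Lemma measurable_thickening (B : set R) (h T : R) : 0 < h -> 0 < T ->
  measurable [set u : R | exists t, B t /\ u * T - h <= t <= u * T + h].
Proof.
move=> h0 T0; set S := [set _ | _].
(* Intervals through a common rational point have an interval as union. *)
pose Sq (q : rat) := [set u : R | exists t, [/\ B t,
  u * T - h <= t <= u * T + h & ratr q * T - h <= t <= ratr q * T + h]].
have -> : S = \bigcup_q Sq q.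
  apply/seteqP; split => u /=; last by move=> [q _ [t [Bt ut _]]]; exists t.
  move=> [t [Bt ut]].
  have [q] : exists q : rat, ratr q \in `](t - h) / T, (t + h) / T[.
    by apply: rat_in_itvoo; rewrite ltr_pM2r ?invr_gt0//; lra.
  rewrite in_itv/= ltr_pdivrMr// ltr_pdivlMr// => /andP[q1 q2].
  by exists q => //; exists t; split => //; apply/andP; split; lra.
apply: bigcupT_measurable_rat => q.
suff /is_intervalP -> : is_interval (Sq q) by exact: measurable_itv.
move=> x y [t [Bt /andP[t1 t2] /andP[t3 t4]]] [s [Bs /andP[s1 s2] /andP[s3 s4]]] z /andP[xz zy].
have xzT : x * T <= z * T by rewrite ler_pM2r.
have zyT : z * T <= y * T by rewrite ler_pM2r.
have [zq|qz] := leP (z * T) (ratr q * T).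
  by exists t; split; [by [] | apply/andP; split; lra | apply/andP; split; lra].
by exists s; split; [by [] | apply/andP; split; lra | apply/andP; split; lra].
Qed.

(** The density is at most 1; this is an inequality because the interval may leave [0, 1]. *)
Lemma uniform01_itv_le (a b : R) : a <= b ->
  (uniform_prob (@ltr01 R) `[a, b] <= (b - a)%:E)%E.
Proof.
move=> ab; apply: (@le_trans _ _ (\int[lebesgue_measure]_(x in `[a, b]) cst 1 x)%E).
  apply: ge0_le_integral => //.
  - by move=> x _; rewrite lee_fin; exact: uniform_pdf_ge0.
  - apply/measurable_EFinP; apply: measurable_funTS; exact: measurable_uniform_pdf.
  - by move=> x _; rewrite lee_fin /uniform_pdf; case: ifP => // _; rewrite subr0 invr1.
rewrite integral_cst//= mul1e lebesgue_measure_itv/= lte_fin; case: ifP => // _.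
by rewrite lee_fin subr_ge0.
Qed.

Lemma uniform01_out : uniform_prob (@ltr01 R) (~` `[0, 1]) = 0%E.
Proof. by rewrite /uniform_prob integral_uniform_pdf setICl integral_set0. Qed.

End Cells.

(** * The large values of zeta *)

Section Tail.
Variables (R : realType) (zeta logzeta : R[i] -> R[i]).
Hypotheses (hzeta : is_riemann_zeta zeta) (hlogzeta : is_log_zeta zeta logzeta).
Local Notation l := (@lnS R).

Definition large_values (M : R) : set R :=
  [set t | log_zeta_dom zeta (critical_pt t) /\
           M < complex.Re (logzeta (critical_pt t))].

(** As $e^M \ge 48$, the additive loss 24 is at most $e^M/2$, so the square root is at least
    $e^M/6$. *)
Lemma large_values_trig_sq (M t : R) (N : nat) : 48 <= expR M -> `|t| <= N%:R ->
  large_values M t -> expR M ^+ 2 / 36 <= trig_sq (@alt_coef R) l N t.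
Proof.
(* At t = 0 the point 1/2 lies on the half-line to the left of the pole, outside the domain. *)
move=> M48 tN [tdom Mt]; have t0 : t != 0.
  apply/eqP => t0; apply: tdom; exists 1; first by left.
  by rewrite /left_half_line /critical_pt t0/=; split => //; lra.
have := norm_zeta_half hzeta t0 tN.
have [_ <- // _] := hlogzeta; rewrite norm_cexp lecR => h1.
have h2 : expR M < 3 * (Num.sqrt (trig_sq (@alt_coef R) l N t) + 8).
  by apply: lt_le_trans h1; rewrite ltr_expR.
have Q0 := trig_sq_ge0 (@alt_coef R) l N t.
rewrite -[leRHS](sqr_sqrtr Q0).
have h3 : expR M / 6 <= Num.sqrt (trig_sq (@alt_coef R) l N t) by lra.
have := @lerXn2r R 2 _ _ _ _ h3; rewrite !nnegrE sqrtr_ge0 => /(_ _ isT).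
have h4 : 0 <= expR M / 6 by rewrite divr_ge0// expR_ge0.
by move=> /(_ h4); rewrite exprMn; lra.
Qed.

(** Union bound over the bad cells, each of probability at most h/T, whose number is controlled by
    the total increment of the majorant u. *)
Lemma uniform_large_values (h : R) : 0 < h -> exists C T0 : R, 3 <= T0 /\
  forall T M, T0 <= T -> 48 <= expR M ->
  (uniform_prob (@ltr01 R)
     [set u : R | exists t, large_values M t /\ (u * T - h <= t <= u * T + h)%R] <=
   (C * (ln T / expR M) ^+ 2)%:E)%E.
Proof.
move=> h0; have [C [T0 [C0 [T03 maj]]]] := cell_majorant h0.
(* The constant is 36 from the lower bound on a bad cell times 3 from the overlap of
   neighbourhoods. *)
exists (108 * h * C), T0; split => // T M TT M48.
have Tp : 0 < T by lra.
have [N [u [um uN ut uK]]] := maj T TT.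
set S := [set _ | _]; set mu := uniform_prob _.
pose V := expR M; have V0 : 0 < V by exact: expR_gt0.
(* K cells cover [0, T], and the last one exceeds T by at most h. *)
pose K := (Num.trunc (T / h)).+1.
have Th0 : 0 <= T / h by rewrite divr_ge0// ltW.
have /andP[K1 K2] := truncn_itv Th0.
have KT : K%:R * h <= T + h.
  rewrite (_ : K%:R = (Num.trunc (T / h))%:R + 1); last by rewrite natr1.
  by move: K1; rewrite ler_pdivlMr//; lra.
pose bad (k : nat) := exists t, large_values M t /\ (k%:R - 1) * h <= t <= (k%:R + 2) * h.
pose cell (k : nat) : set R :=
  if `[< bad k >] then `[k%:R * h / T, (k%:R + 1) * h / T]%classic else set0.
have mcell k : measurable (cell k) by rewrite /cell; case: ifP.
have cellP k : (k < K)%N -> (mu (cell k) <= (h / T * (36 / V ^+ 2) * (u k.+3 - u k))%:E)%E.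
  move=> kK; have uk : 0 <= u k.+3 - u k by rewrite subr_ge0 um// ltnW// ltnW.
  have hT : 0 < h / T by rewrite divr_gt0.
  have V2 : 0 < 36 / V ^+ 2 by rewrite divr_gt0// exprn_gt0.
  rewrite /cell; case: asboolP => [[t [Bt kt]]|_]; last first.
    by rewrite /mu measure0 lee_fin mulr_ge0// mulr_ge0// ltW.
  have kN : (k.+1%:R : R) <= K%:R by rewrite ler_nat.
  have tN : `|t| <= N%:R.
    have k0 : 0 <= k%:R * h by rewrite mulr_ge0// ltW.
    have kh : (k%:R + 1) * h <= T + h.
      by apply: le_trans KT; rewrite ler_pM2r// natr1.
    by apply: le_trans uN; move/andP: kt => [k1 k2]; rewrite ler_norml; apply/andP; split; lra.
  (* On a bad cell this quantity is at least 1, so the length h/T may be multiplied by it. *)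
  have le1 : 1 <= 36 / V ^+ 2 * (u k.+3 - u k).
    apply: le_trans (ler_wpM2l (ltW V2)
      (le_trans (large_values_trig_sq M48 tN Bt) (ut k t kt))).
    by rewrite -/V le_eqVlt; apply/orP; left; apply/eqP; field; rewrite gt_eqF.
  apply: le_trans (uniform01_itv_le _) _.
    by rewrite ler_pM2r ?invr_gt0// ler_pM2r// lerDl.
  have -> : (k%:R + 1) * h / T - k%:R * h / T = h / T * 1 by field; rewrite gt_eqF.
  rewrite lee_fin -[leRHS]mulrA.
  by rewrite ler_pM2l.
have mS : measurable S by exact: measurable_thickening.
(* A point x of S in [0, 1] has xT in the cell of index trunc(xT/h); its witness t is within h of
   xT, so that cell is bad. *)
have Ssub : S `<=` ~` `[0, 1]%classic `|` \big[setU/set0]_(k < K) cell k.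
  move=> x [t [Bt xt]]; have [x01|] := pselect (`[0, 1]%classic x); last by left.
  right; move: x01; rewrite /= in_itv/= => /andP[x0 x1].
  have xT0 : 0 <= x * T / h by rewrite divr_ge0 ?mulr_ge0// ltW.
  have /andP[k1 k2] := truncn_itv xT0; set k := Num.trunc (x * T / h) in k1 k2.
  have kK : (k < K)%N.
    rewrite -(ltr_nat R); apply: le_lt_trans k1 _; apply: le_lt_trans K2.
    by rewrite ler_pM2r ?invr_gt0// -[leRHS]mul1r ler_pM2r.
  move: k1 k2; rewrite ler_pdivlMr// ltr_pdivrMr// -natr1 => k1 k2.
  rewrite -bigcup_mkord; exists k => //; rewrite /cell asboolT.
    by rewrite /= in_itv/= ler_pdivrMr// ler_pdivlMr//; apply/andP; split; lra.
  by exists t; split => //; move/andP: xt => [? ?]; apply/andP; split; lra.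
have mout : measurable (~` `[0, 1]%classic : set R) by exact: measurableC.
have mU : measurable (\big[setU/set0]_(k < K) cell k).
  by apply: bigsetU_measurable => k _; exact: mcell.
apply: (@le_trans _ _ (mu (~` `[0, 1]%classic `|` \big[setU/set0]_(k < K) cell k))).
  rewrite /mu; apply: le_measure => //; rewrite inE//; exact: measurableU.
apply: le_trans; first by rewrite /mu; exact: measureU2.
rewrite [X in (X + _)%E]uniform01_out add0e.
apply: le_trans; first by rewrite /mu; apply: Boole_inequality => k _; exact: mcell.
apply: (@le_trans _ _ (\sum_(k < K) (h / T * (36 / V ^+ 2) * (u k.+3 - u k))%:E)%E).
  by apply: lee_sum => k _; exact: cellP.
rewrite sumEFin lee_fin -mulr_sumr -(big_mkord xpredT (fun k => u k.+3 - u k)).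
have c0 : 0 <= h / T * (36 / V ^+ 2).
  by apply: mulr_ge0; apply: divr_ge0; rewrite ?exprn_ge0// ltW.
apply: le_trans (ler_wpM2l c0 (sum_shift3_le K um)) _.
apply: (@le_trans _ _ (h / T * (36 / V ^+ 2) * (3 * (C * T * ln T ^+ 2)))).
  by rewrite ler_wpM2l// ler_wpM2l// uK.
rewrite le_eqVlt; apply/orP; left; apply/eqP; rewrite exprMn exprVn -/V.
by field; rewrite !gt_eqF.
Qed.

End Tail.

(** * Convergence of the probability to 1 *)

Theorem theorem2 (R : realType)
    (zeta : R[i] -> R[i]) (hzeta : is_riemann_zeta zeta)
    (logzeta : R[i] -> R[i]) (hlogzeta : is_log_zeta zeta logzeta)
    (d : measure_display) (Omega : measurableType d) (P : probability Omega R)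
    (U : {RV P >-> R})
    (hU : forall A : set R, measurable A ->
       distribution P U A = uniform_prob (@ltr01 R) A)
    (h : R) (hh : 0 < h)
    (g : R -> R) (hg0 : forall T : R, 3 <= T -> 0 <= g T)
    (hg : g T @[T --> +oo] --> +oo) :
  P [set w | (sup_Re_log_zeta zeta logzeta (U w * T - h) (U w * T + h)
              <= (ln (ln T) + g T)%:E)%E] @[T --> +oo] --> 1%E.
Proof.
have [C [T0 [T03 bnd]]] := uniform_large_values hzeta hlogzeta hh.
pose M T := ln (ln T) + g T.
pose S T : set R := [set u : R | exists t,
  large_values zeta logzeta (M T) t /\ u * T - h <= t <= u * T + h].
(* The supremum exceeds the bound exactly when some value does; over an empty set it is minus
   infinity, which agrees with the absence of large values. *)
have evE T : [set w | (sup_Re_log_zeta zeta logzeta (U w * T - h) (U w * T + h)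
              <= (ln (ln T) + g T)%:E)%E] = ~` (U @^-1` S T).
  apply/seteqP; split => w /=.
    move=> supM [t [[tdom Mt] wt]]; have : ((M T)%:E < (M T)%:E)%E.
      apply: lt_le_trans supM; apply: (@lt_le_trans _ _
        (complex.Re (logzeta (critical_pt t)))%:E); first by rewrite lte_fin.
      by apply: ereal_sup_ubound; exists t.
    by rewrite ltxx.
  move=> nS; apply: ge_ereal_sup => _ [t [wt tdom] <-]; rewrite lee_fin leNgt.
  by apply/negP => Mt; apply: nS; exists t.
have e1 : 0 < expR (1 : R) by exact: expR_gt0.
(* It suffices that $e^{2g} \ge 1 + 2g \ge |C|/e$, the last e being the tolerance. *)
have small : C * expR (- (2 * g T)) @[T --> +oo] --> 0.
  apply/cvgrPdist_le => e e0; near=> T; rewrite sub0r normrN normrM.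
  rewrite (ger0_norm (expR_ge0 _)) expRN ler_pdivrMr ?expR_gt0//.
  have gT : `|C| / e <= g T by near: T; move/cvgryPge : hg; apply.
  rewrite mulrC -ler_pdivrMr//; apply: (le_trans gT).
  have g0 : 0 <= g T by apply: le_trans gT; rewrite divr_ge0// ltW.
  by have := expR_ge1Dx (2 * g T); lra.
have lower : (1 - C * expR (- (2 * g T)))%:E @[T --> +oo] --> 1%E.
  apply: cvg_EFin; first exact: nearW.
  rewrite -[X in _ --> X](subr0 (1 : R)); apply: cvgB small; exact: cvg_cst.
(* The probability lies between $1 - C e^{-2g(T)}$ and 1. *)
apply: squeeze_cvge lower (cvg_cst _); near=> T.
have TT0 : T0 <= T by near: T; apply: nbhs_pinfty_ge; exact: num_real.
have Te : expR 1 <= T by near: T; apply: nbhs_pinfty_ge; exact: num_real.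
have g48 : 48 <= g T by near: T; move/cvgryPge : hg; apply.
have Tp : 0 < T by lra.
have lT : 1 <= ln T by rewrite -(@expRK _ 1) ler_ln ?posrE.
(* The factor ln T cancels in $(\ln T / e^M)^2$ and leaves $e^{-2g(T)}$; this is why the threshold
   is log log T. *)
have eM : expR (M T) = ln T * expR (g T).
  by rewrite /M expRD lnK// posrE; lra.
have M48 : 48 <= expR (M T).
  rewrite eM -[48]mul1r; apply: ler_pM => //.
  by have := expR_ge1Dx (g T); lra.
have mS : measurable (S T) by exact: measurable_thickening.
have mUS : measurable (U @^-1` S T) by exact: measurable_funPTI.
rewrite evE; apply/andP; split; last by apply: probability_le1; exact: measurableC.
rewrite probability_setC//; have -> : P (U @^-1` S T) = uniform_prob (@ltr01 R) (S T).
  by rewrite -hU.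
rewrite EFinB; apply: leeB => //; apply: le_trans (bnd T (M T) TT0 M48) _.
rewrite lee_fin eM (_ : (ln T / _) ^+ 2 = expR (- (2 * g T)))//.
rewrite invfM mulrA mulfV ?mul1r; last by rewrite gt_eqF//; lra.
by rewrite -expRN expr2 -expRD; congr expR; ring.
Unshelve. all: by end_near. Qed.
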